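(* Let $x$ be a quaternionic variable. For every integer $m\ge1$ and every $a\in\partial\mathbb{B}$: (a) $\mathcal{Z}_{m-1}(x,1)=m\,(x^m)'_s$. Therefore $\overline\partial_{CRF}(x^m)=-\frac2m\mathcal{Z}_{m-1}(x,1)$. (b) $\mathcal{Z}_{m-1}(x,a)=\mathcal{Z}_{m-1}(x\overline a,1)=m\,(y^m)'_s\big|_{y=x\overline a}=m\sum_{k=0}^{m-1}(x\overline a)^{m-k-1}(a\overline x)^k$. (c) $(x^{-m})'_s=-\mathcal{K}\left[(x^m)'_s\right]$, where $\mathcal{K}$ is the Kelvin transform in $\mathbb{R}^4$. The functions $(x^{-m})'_s$ are harmonic on $\mathbb{R}^4\setminus\{0\}$. (d) $x^m=\frac1{m+1}\mathcal{Z}_m(x,1)-\overline x\,\frac1m\,\mathcal{Z}_{m-1}(x,1)$. (e) The restriction of $(x^m)'_s$ to the unit sphere $\partial\mathbb{B}$ is equal to the Gegenbauer polynomial $C^{(1)}_{m-1}(\operatorname{Re}(x))$. (f) The quaternionic Koebe function $f_K(x)=(1-x)^{-2}x$ is slice-regular on $\mathbb{H}\setminus\{1\}$ and $(f_K)'_s(x)=\mathcal{P}(x,1)$, $(f_K)'_s(x\overline a)=\mathcal{P}(x,a)$ for every $x\in\mathbb{B}$, $a\in\partial\mathbb{B}$, where $\mathcal{P}(x,a)$ is the Poisson kernel of $\mathbb{B}$.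
   Context: $\mathbb{H}\simeq\mathbb{R}^4$ is the algebra of quaternions $x=x_0+x_1i+x_2j+x_3k$, with conjugation $\overline x=x_0-x_1i-x_2j-x_3k$, $\operatorname{Re}(x)=x_0$, $\operatorname{Im}(x)=x_1i+x_2j+x_3k$; $\mathbb{B}$ is the open unit ball of $\mathbb{R}^4\simeq\mathbb{H}$; $\mathbb{S}_{\mathbb{H}}=\{J\in\mathbb{H}:J^2=-1\}$; $\overline\partial_{CRF}=\frac{\partial}{\partial x_0}+i\frac{\partial}{\partial x_1}+j\frac{\partial}{\partial x_2}+k\frac{\partial}{\partial x_3}$. For $D\subseteq\mathbb{C}$ invariant under complex conjugation, $\Omega_D=\{\alpha+J\beta:\alpha+\sqrt{-1}\,\beta\in D,\ J\in\mathbb{S}_{\mathbb{H}}\}$. A stem function on $D$ is a map $F=F_1+\imath F_2:D\to\mathbb{H}\otimes_{\mathbb{R}}\mathbb{C}$ ($F_1,F_2$ being $\mathbb{H}$-valued, $\imath^2=-1$) with $F(\overline z)=\overline{F(z)}$, where $\overline{a+\imath b}=a-\imath b$ for $a,b\in\mathbb{H}$. It induces the (left) slice function $f=\mathcal{I}(F):\Omega_D\to\mathbb{H}$, $f(\alpha+J\beta)=F_1(z)+JF_2(z)$, $z=\alpha+\sqrt{-1}\,\beta$; $f$ is slice-regular if $F$ is holomorphic (with respect to the complex structure given by $\imath$). The spherical derivative of $f$ is $f'_s(x)=\frac12\operatorname{Im}(x)^{-1}(f(x)-f(\overline x))$ for $x\notin\mathbb{R}$; for $f$ slice-regular it extends continuously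 to real points. $(x^m)'_s$ denotes the spherical derivative of $x\mapsto x^m$. $\mathcal{Z}_m(x,a)$, $a\in\partial\mathbb{B}$, is the four-dimensional (solid) zonal harmonic of degree $m$ with pole $a$: the unique homogeneous harmonic polynomial of degree $m$ in $x\in\mathbb{R}^4$ such that $p(a)=\int_{\partial\mathbb{B}}p(\zeta)\mathcal{Z}_m(\zeta,a)\,d\sigma(\zeta)$ for every homogeneous harmonic polynomial $p$ of degree $m$ on $\mathbb{R}^4$, with $\sigma$ the normalized surface measure (so $\mathcal{Z}_m(a,a)=(m+1)^2$). The Kelvin transform in $\mathbb{R}^4$ is $\mathcal{K}[f](x)=|x|^{-2}f(x/|x|^2)$. $C^{(1)}_k$ is the Gegenbauer polynomial of degree $k$ with parameter $1$. $\mathcal{P}(x,a)=\frac{1-|x|^2}{|x-a|^4}$ for $x\in\mathbb{B}$, $a\in\partial\mathbb{B}$. *)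

(* Defs.v *)
From HB Require Import structures.
From mathcomp Require Import all_boot all_order all_algebra.
From mathcomp Require Import all_classical all_reals all_analysis.
From mathcomp Require Import complex ring.
(* The notations of mpoly clash with those of MathComp-Analysis. *)
From mathcomp Require Import -(notations) mpoly.

Set Implicit Arguments.
Unset Strict Implicit.
Unset Printing Implicit Defensive.

Import Order.TTheory GRing.Theory Num.Theory numFieldNormedType.Exports.

Local Open Scope classical_set_scope.
Local Open Scope complex_scope.
Local Open Scope ring_scope.

(* A quaternion is the row of its coordinates in the basis 1, i, j, k. The norm
   `|x| inherited from 'rV[R]_4 is the sup norm, used only for the topology and
   for derivatives; the Euclidean norm is qabs below. *)
Definition quat (R : realType) : Type := 'rV[R]_4.

HB.instance Definition _ (R : realType) :=
  NormedModule.copy (quat R) 'rV[R]_4.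

Section Quaternions.
Variable R : realType.
Implicit Types x y : quat R.

Definition Quat (a b c d : R) : quat R := \row_(i < 4) [:: a; b; c; d]`_i.

Definition qcoord (n : nat) x : R := x ord0 (inord n).

Local Notation "x _[ n ]" := (qcoord n x) (at level 2, n at level 0).

Lemma qcoordE (a b c d : R) n : (n < 4)%N ->
  (Quat a b c d) _[n] = [:: a; b; c; d]`_n.
Proof. by move=> lt_n4; rewrite /qcoord mxE inordK. Qed.

Lemma quatP x y : (forall n, (n < 4)%N -> x _[n] = y _[n]) -> x = y.
Proof.
move=> exy; apply/rowP => i; have := exy i (ltn_ord i).
by rewrite /qcoord inord_val.
Qed.

Definition qmul x y : quat R :=
  Quat (x _[0] * y _[0] - x _[1] * y _[1] - x _[2] * y _[2] - x _[3] * y _[3])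
       (x _[0] * y _[1] + x _[1] * y _[0] + x _[2] * y _[3] - x _[3] * y _[2])
       (x _[0] * y _[2] - x _[1] * y _[3] + x _[2] * y _[0] + x _[3] * y _[1])
       (x _[0] * y _[3] + x _[1] * y _[2] - x _[2] * y _[1] + x _[3] * y _[0]).

Definition qone : quat R := Quat 1 0 0 0.

Lemma qcoordD n x y : (x + y) _[n] = x _[n] + y _[n].
Proof. by rewrite /qcoord mxE. Qed.

Lemma qcoordN n x : (- x) _[n] = - x _[n].
Proof. by rewrite /qcoord mxE. Qed.

Lemma qcoordZ n (a : R) x : (a *: x) _[n] = a * x _[n].
Proof. by rewrite /qcoord mxE. Qed.

Lemma qcoord0 n : (0 : quat R) _[n] = 0.
Proof. by rewrite /qcoord mxE. Qed.

Let qE := (qcoordD, qcoordN, qcoordZ, qcoord0, qcoordE).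

Fact qmulA : associative qmul.
Proof. by move=> x y z; apply: quatP => -[|[|[|[|]]]] //= _; rewrite !qE //=; ring. Qed.

Fact qmul1q : left_id qone qmul.
Proof. by move=> x; apply: quatP => -[|[|[|[|]]]] //= _; rewrite !qE //=; ring. Qed.

Fact qmulq1 : right_id qone qmul.
Proof. by move=> x; apply: quatP => -[|[|[|[|]]]] //= _; rewrite !qE //=; ring. Qed.

Fact qmulDl : left_distributive qmul +%R.
Proof. by move=> x y z; apply: quatP => -[|[|[|[|]]]] //= _; rewrite !qE //=; ring. Qed.

Fact qmulDr : right_distributive qmul +%R.
Proof. by move=> x y z; apply: quatP => -[|[|[|[|]]]] //= _; rewrite !qE //=; ring. Qed.

Fact qone_neq0 : qone != 0.
Proof.
apply/eqP => /(congr1 (qcoord 0)) /eqP; rewrite !qE //=.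
by rewrite oner_eq0.
Qed.

HB.instance Definition _ := GRing.Zmodule_isNzRing.Build (quat R)
  qmulA qmul1q qmulq1 qmulDl qmulDr qone_neq0.

Lemma qmulE x y : x * y = qmul x y. Proof. by []. Qed.

Lemma qoneE : 1 = qone. Proof. by []. Qed.

Fact qscaleAl (a : R) x y : a *: (x * y) = (a *: x) * y.
Proof. by rewrite !qmulE; apply: quatP => -[|[|[|[|]]]] //= _; rewrite !qE //=; ring. Qed.

Fact qscaleAr (a : R) x y : a *: (x * y) = x * (a *: y).
Proof. by rewrite !qmulE; apply: quatP => -[|[|[|[|]]]] //= _; rewrite !qE //=; ring. Qed.

HB.instance Definition _ := GRing.Lmodule_isLalgebra.Build R (quat R) qscaleAl.
HB.instance Definition _ := GRing.Lalgebra_isAlgebra.Build R (quat R) qscaleAr.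

Definition qre x : R := x _[0].
Definition qim x : quat R := Quat 0 x _[1] x _[2] x _[3].
Definition qconj x : quat R := Quat x _[0] (- x _[1]) (- x _[2]) (- x _[3]).
Definition qnorm2 x : R := x _[0] ^+ 2 + x _[1] ^+ 2 + x _[2] ^+ 2 + x _[3] ^+ 2.
Definition qabs x : R := Num.sqrt (qnorm2 x).
Definition qinv x : quat R := (qnorm2 x)^-1 *: qconj x.

Lemma qnorm2_eq0 x : (qnorm2 x == 0) = (x == 0).
Proof.
apply/eqP/eqP => [|->]; last by rewrite /qnorm2 !qE expr0n /= !addr0.
move/eqP; rewrite /qnorm2 !paddr_eq0 ?addr_ge0 ?sqr_ge0 // !sqrf_eq0.
move=> /andP[/andP[/andP[/eqP x0 /eqP x1] /eqP x2] /eqP x3].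
by apply: quatP => -[|[|[|[|]]]] //= _; rewrite qE.
Qed.

Fact qmulVq : {in [pred x | x != 0], left_inverse 1 qinv *%R}.
Proof.
move=> x; rewrite inE /= -qnorm2_eq0 => x0; rewrite qmulE qoneE.
apply: quatP => -[|[|[|[|]]]] //= _; rewrite !qE //= /qnorm2 in x0 *; by field.
Qed.

Fact qmulqV : {in [pred x | x != 0], right_inverse 1 qinv *%R}.
Proof.
move=> x; rewrite inE /= -qnorm2_eq0 => x0; rewrite qmulE qoneE.
apply: quatP => -[|[|[|[|]]]] //= _; rewrite !qE //= /qnorm2 in x0 *; by field.
Qed.

Fact qunitP x y : y * x = 1 /\ x * y = 1 -> x \in [pred x | x != 0].
Proof.
move=> [yx1 _]; rewrite inE; apply/eqP => x0.
by move: yx1; rewrite x0 mulr0 => /esym/eqP; rewrite oner_eq0.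
Qed.

Fact qinv_out : {in [predC [pred x | x != 0]], qinv =1 id}.
Proof.
move=> x; rewrite !inE negbK => /eqP ->.
by apply: quatP => -[|[|[|[|]]]] //= _; rewrite !qE //= ?oppr0 mulr0.
Qed.

HB.instance Definition _ := GRing.NzRing_hasMulInverse.Build (quat R)
  qmulVq qmulqV qunitP qinv_out.

Definition qi : quat R := Quat 0 1 0 0.
Definition qj : quat R := Quat 0 0 1 0.
Definition qk : quat R := Quat 0 0 0 1.

Definition unit_ball : set (quat R) := [set x | qabs x < 1].
Definition unit_sphere : set (quat R) := [set x | qabs x = 1].

(* The directions of the partial derivatives 'D_(qbase n) = d/dx_n. *)
Definition qbase (n : 'I_4) : quat R := [:: 1; qi; qj; qk]`_n.

Definition dCRF (f : quat R -> quat R) (x : quat R) : quat R :=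
  'D_1 f x + qi * 'D_qi f x + qj * 'D_qj f x + qk * 'D_qk f x.

Definition C2_on (V : normedModType R) (U : set (quat R)) (f : quat R -> V) :=
  forall x, U x ->
    {for x, continuous f} /\
    forall m : 'I_4,
      [/\ derivable f x (qbase m), {for x, continuous ('D_(qbase m) f)} &
        forall n : 'I_4,
          derivable ('D_(qbase m) f) x (qbase n) /\
          {for x, continuous ('D_(qbase n) ('D_(qbase m) f))}].

Definition laplacian (V : normedModType R) (f : quat R -> V) (x : quat R) : V :=
  \sum_(n < 4) 'D_(qbase n) ('D_(qbase n) f) x.

Definition harmonic_on (V : normedModType R) (U : set (quat R))
    (f : quat R -> V) :=
  [/\ open U, C2_on U f & forall x, U x -> laplacian f x = 0].

Definition kelvin (V : lmodType R) (f : quat R -> V) (x : quat R) : V :=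
  qabs x ^- 2 *: f (qabs x ^- 2 *: x).

Definition poisson (x a : quat R) : R :=
  (1 - qabs x ^+ 2) / qabs (x - a) ^+ 4.

(* At real points the spherical derivative is the limit along non-real points. *)
Definition sph_quot (f : quat R -> quat R) (x : quat R) : quat R :=
  2^-1 *: ((qim x)^-1 * (f x - f (qconj x))).

Definition sph_deriv (f : quat R -> quat R) (x : quat R) : quat R :=
  if qim x != 0 then sph_quot f x
  else lim (sph_quot f y @[y --> within [set y | qim y != 0] (nbhs x)]).

Definition imag_units : set (quat R) := [set J | J ^+ 2 = -1].

(* The point alpha + J beta, for z = alpha + i beta. *)
Definition slice_pt (z : R[i]) (J : quat R) : quat R :=
  (complex.Re z)%:A + J * (complex.Im z)%:A.

Definition circularization (D : set R[i]) : set (quat R) :=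
  [set x | exists z J, [/\ D z, imag_units J & x = slice_pt z J]].

(* H (x)_R C, as the complex vector space C^4: a + \imath b has coordinates
   a_n + 'i b_n in the basis 1, i, j, k. *)
Definition quatC : Type := 'rV[R[i]]_4.

Definition quatC_fst (w : quatC) : quat R := map_mx (@complex.Re R) w.
Definition quatC_snd (w : quatC) : quat R := map_mx (@complex.Im R) w.
Definition quatC_conj (w : quatC) : quatC := map_mx (@conjc R) w.

Definition conj_invariant (D : set R[i]) := forall z, D z -> D z^*.

Definition stem_function (D : set R[i]) (F : R[i] -> quatC) :=
  forall z, D z -> F z^* = quatC_conj (F z).

Definition induced_by (D : set R[i]) (F : R[i] -> quatC)
    (f : quat R -> quat R) :=
  forall z J, D z -> imag_units J ->
    f (slice_pt z J) = quatC_fst (F z) + J * quatC_snd (F z).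

Definition holomorphic_on (D : set R[i]) (F : R[i] -> quatC) :=
  forall z, D z -> derivable (F : R[i]^o -> 'rV[R[i]]_4) z 1.

Definition slice_regular (U : set (quat R)) (f : quat R -> quat R) :=
  exists (D : set R[i]) (F : R[i] -> quatC),
    [/\ open (D : set R[i]^o), conj_invariant D & U = circularization D] /\
    [/\ stem_function D F, holomorphic_on D F & induced_by D F f].

Definition koebe (x : quat R) : quat R := (1 - x) ^- 2 * x.

(* Normalized surface measure of the sphere in hyperspherical coordinates: the
   area element is (sin u)^2 * sin v du dv dw and the total area is 2 * pi^2. *)
Definition sphere_pt (u v w : R) : quat R :=
  Quat (cos u) (sin u * cos v) (sin u * sin v * cos w) (sin u * sin v * sin w).

Definition sphere_mean (f : quat R -> R) : R :=
  (2 * pi ^+ 2)^-1 *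
  \int[lebesgue_measure]_(u in `[0, pi])
    \int[lebesgue_measure]_(v in `[0, pi])
      \int[lebesgue_measure]_(w in `[0, 2 * pi])
        (f (sphere_pt u v w) * (sin u ^+ 2 * sin v)).

Definition peval (p : mpoly 4 R) (x : quat R) : R :=
  meval (fun n => x ord0 n) p.

Definition homog_harmonic (m : nat) (p : mpoly 4 R) :=
  p \is ishomog1 m mdeg /\
  harmonic_on [set: quat R] (peval p : quat R -> R^o).

Definition is_zonal (m : nat) (a : quat R) (Z : mpoly 4 R) :=
  homog_harmonic m Z /\
  forall p, homog_harmonic m p ->
    peval p a = sphere_mean (fun y => peval p y * peval Z y).

Definition zonal (m : nat) (x a : quat R) : R :=
  peval (xget 0 [set Z | is_zonal m a Z]) x.

(* k C_k = 2 (k + l - 1) t C_(k-1) - (k + 2 l - 2) C_(k-2) for k >= 2. *)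
Fixpoint gegenbauer (l : R) (k : nat) : {poly R} :=
  match k with
  | 0%N => 1
  | 1%N => (2 * l) *: 'X
  | (k'.+1 as k1).+1 =>
      (k'.+2%:R)^-1 *: ((2 * (k'.+1%:R + l)) *: ('X * gegenbauer l k1)
                        - (k'%:R + 2 * l) *: gegenbauer l k')
  end.

End Quaternions.

(* Main.v *)
Require Import Defs.
From HB Require Import structures.
From mathcomp Require Import all_boot all_order all_algebra.
From mathcomp Require Import all_classical all_reals all_analysis.
From mathcomp Require Import complex ring zify.
From mathcomp Require Import -(notations) mpoly.

Set Implicit Arguments.
Unset Strict Implicit.
Unset Printing Implicit Defensive.

Import Order.TTheory GRing.Theory Num.Theory numFieldNormedType.Exports.
Local Open Scope classical_set_scope.
Local Open Scope ring_scope.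

(**
  Powers and zonal harmonics are linked by one family of polynomials. For a unit vector a
  let U_0 = 1, U_1 = 2 (a . x) and U_(n+2) = 2 (a . x) U_(n+1) - |x|^2 U_n: this
  is the Chebyshev polynomial of the second kind made homogeneous.

  On the algebraic side take a = 1. A quaternion satisfies
  x^2 = 2 Re(x) x - |x|^2, and so does its conjugate y. Hence powers obey the
  recurrence of the U_n, and one gets that x^m - y^m is 2 Im(x) U_(m-1), that
  sum_k x^(n-k) y^k = U_n and that x^m = U_m - y U_(m-1). So the spherical
  derivative of x^m is U_(m-1), first at the non-real points and then everywhere
  by continuity. On the unit sphere U_n is the Gegenbauer polynomial of Re(x).
  The Cauchy-Riemann-Fueter operator follows from the Leibniz rule and from
  q + iqi + jqj + kqk = -2 conj(q) (dCRF_exprn).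

  On the analytic side, (m+1) U_m is the zonal harmonic of degree m with pole a
  (zonalE). Its harmonicity comes from the recurrence, because the derivative of
  U_(n+1) along a is (n+2) U_n (mlap_zpoly). The reproducing property rests on
  the divergence theorem for polynomials: if f is homogeneous of degree d, then
  d + 3 times the mean of x_i f is the mean of d_i f (sphere_mean_mulX), which on
  monomials is a relation between Wallis integrals. Together with Euler's identity it shows, by induction
  on m, that a harmonic polynomial p of degree m has mean 0 against (a . x)^n for
  n < m, and mean p(a) / (2^m (m+1)) against (a . x)^m
  (mean_homog_harmonic_linpolyX). As U_m restricted to the sphere is a polynomial
  of degree m in a . x with leading coefficient 2^m, the reproducing property
  follows. Uniqueness comes from reproduction itself: a second kernel Z and the
  kernels just built reproduce each other (is_zonal_unique).

  A pole a is brought to 1 by the rotation that multiplies x by the conjugate of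
  a on the right. The spherical derivative of x^-m is -U_(m-1) / |x|^(2m), minus
  the Kelvin transform of U_(m-1), and a direct computation of its second
  derivatives shows that it is harmonic (rat_on_harmonic). For the Koebe function
  the difference quotient is an algebraic identity, and its stem function is the
  complex function z / (1 - z)^2.
*)

(** * Preliminaries *)

Lemma nat_ind2 (P : nat -> Prop) :
  P 0%N -> P 1%N -> (forall n, P n -> P n.+1 -> P n.+2) -> forall n, P n.
Proof.
move=> P0 P1 PS n; suff [] : P n /\ P n.+1 by [].
by elim: n => [//|n [Pn PSn]]; split=> //; exact: PS.
Qed.

Lemma ord4_ind (P : 'I_4 -> Prop) :
  P (inord 0) -> P (inord 1) -> P (inord 2) -> P (inord 3) -> forall i, P i.
Proof.
move=> P0 P1 P2 P3 i; rewrite -(inord_val i).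
by case: i => -[|[|[|[|]]]].
Qed.

Lemma big_ord4 (T : Type) (idx : T) (op : Monoid.law idx) (F : 'I_4 -> T) :
  \big[op/idx]_(i < 4) F i
    = op (op (op (F (inord 0)) (F (inord 1))) (F (inord 2))) (F (inord 3)).
Proof.
rewrite !big_ord_recr big_ord0 /= Monoid.mul1m.
by congr (op (op (op (F _) (F _)) (F _)) (F _)); apply/val_inj; rewrite /= inordK.
Qed.

Lemma inord4_eq k l : (k < 4)%N -> (l < 4)%N ->
  (inord k == inord l :> 'I_4) = (k == l).
Proof. by move=> k4 l4; rewrite -val_eqE /= !inordK. Qed.

Lemma near_neq (T : topologicalType) (x y : T) :
  hausdorff_space T -> x != y -> \forall z \near x, z != y.
Proof.
move=> hT xy; apply: (open_nbhs_nbhs (A := [set z | z != y])); split => //.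
have -> : [set z | z != y] = ~` [set y].
  by apply/seteqP; split=> z /= /eqP.
exact/closed_openC/accessible_closed_set1/hausdorff_accessible.
Qed.

(** * Wallis integrals *)

Section Wallis.
Variable R : realType.
Implicit Types (a b : R) (f F : R -> R) (m n : nat).

Let mu := @lebesgue_measure R.

Lemma continuous_integrable_itv a b f :
  continuous f -> mu.-integrable `[a, b] (EFin \o f).
Proof.
move=> cf; apply: continuous_compact_integrable; first exact: segment_compact.
exact: continuous_subspaceT.
Qed.

Lemma Rintegral_sum_continuous (I : Type) (s : seq I) (k : I -> R)
    (g : I -> R -> R) a b : (forall i, continuous (g i)) ->
  \int[mu]_(x in `[a, b]) (\sum_(i <- s) k i * g i x)
    = \sum_(i <- s) k i * \int[mu]_(x in `[a, b]) g i x.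
Proof.
move=> cg; elim: s => [|i s IHs].
  rewrite big_nil; under eq_Rintegral do rewrite big_nil.
  by rewrite Rintegral_cst // mul0r.
rewrite big_cons -IHs; under eq_Rintegral do rewrite big_cons.
have ck : continuous (fun x => k i * g i x).
  by move=> x; apply: cvgM; [exact: cvg_cst|exact: cg].
rewrite RintegralD //.
- by rewrite RintegralZl //; exact: continuous_integrable_itv.
- exact: (@continuous_integrable_itv a b (fun x => k i * g i x)).
- apply: (@continuous_integrable_itv a b (fun x => \sum_(j <- s) k j * g j x)).
  move=> x; elim: s {IHs} => [|j s IHs].
    by under eq_fun do rewrite big_nil; exact: cvg_cst.
  under eq_fun do rewrite big_cons.
  by apply: cvgD => //; apply: cvgM; [exact: cvg_cst|exact: cg].
Qed.

Lemma Rintegral_derive a b f F : a < b -> continuous f ->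
  (forall x : R, is_derive x 1 F (f x)) ->
  \int[mu]_(x in `[a, b]) f x = F b - F a.
Proof.
move=> ab cf dF.
have cF : continuous F.
  move=> x; apply/differentiable_continuous/derivable1_diffP.
  by have [] := dF x.
rewrite /Rintegral (@continuous_FTC2 _ f F) //.
- exact: continuous_subspaceT.
- split.
  + by move=> x _; have [] := dF x.
  + exact/cvg_at_right_filter/cF.
  + exact/cvg_at_left_filter/cF.
- by move=> x _; rewrite derive1E; have [_ ->] := dF x.
Qed.

Definition wallis a b m n : R :=
  \int[mu]_(x in `[a, b]) (cos x ^+ m * sin x ^+ n).

Lemma continuous_cosX_sinX m n :
  continuous (fun x : R => cos x ^+ m * sin x ^+ n).
Proof.
move=> x; apply: cvgM.
  by apply: (@continuous_comp _ _ _ (@cos R) (fun y => y ^+ _));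
    [exact: continuous_cos|exact: exprn_continuous].
by apply: (@continuous_comp _ _ _ (@sin R) (fun y => y ^+ _));
    [exact: continuous_sin|exact: exprn_continuous].
Qed.

Lemma wallis_pyth a b m n :
  wallis a b m n = wallis a b m.+2 n + wallis a b m n.+2.
Proof.
rewrite /wallis -RintegralD //; try
  exact: (@continuous_integrable_itv a b _ (@continuous_cosX_sinX _ _)).
apply: eq_Rintegral => x _; rewrite -{1}[_ ^+ n]mul1r -(cos2Dsin2 x) !exprS.
by ring.
Qed.

Lemma is_derive_cosX_sinX m n (x : R) :
  is_derive x 1 (fun x : R => cos x ^+ m * sin x ^+ n)
    (n%:R * (cos x ^+ m.+1 * sin x ^+ n.-1)
      - m%:R * (cos x ^+ m.-1 * sin x ^+ n.+1)).
Proof.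
have -> : (fun x : R => cos x ^+ m * sin x ^+ n) = cos ^+ m * sin ^+ n.
  by apply/funext => y; rewrite /= !exprfctE.
apply: (is_derive_eq (is_deriveM (is_deriveX m (is_derive_cos x))
  (is_deriveX n (is_derive_sin x)))).
rewrite /GRing.scale /= !exprfctE !exprS; by ring.
Qed.

(** The derivative of cos^m sin^n is integrated. Every other formula for these
    integrals follows from this one and cos^2 + sin^2 = 1. *)
Lemma wallis_deriv a b m n : a < b ->
  n%:R * wallis a b m.+1 n.-1 - m%:R * wallis a b m.-1 n.+1
    = cos b ^+ m * sin b ^+ n - cos a ^+ m * sin a ^+ n.
Proof.
move=> ab; rewrite -(Rintegral_derive ab _ (is_derive_cosX_sinX m n)); last first.
  move=> x; apply: cvgB; apply: cvgM; try exact: cvg_cst;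
  exact: continuous_cosX_sinX.
have ci k p q : mu.-integrable `[a, b]
    (EFin \o (fun x => k * (cos x ^+ p * sin x ^+ q))).
  apply: (@continuous_integrable_itv a b (fun x => k * _)) => x.
  by apply: cvgM; [exact: cvg_cst|exact: continuous_cosX_sinX].
rewrite RintegralB //; try exact: ci.
by congr (_ - _); rewrite /wallis RintegralZl //;
  exact: (@continuous_integrable_itv a b _ (@continuous_cosX_sinX _ _)).
Qed.

(* On both ranges of the hyperspherical angles, [0, pi] and [0, 2 pi], the sine
   vanishes at the ends, which kills the boundary terms. *)
Section SinVanishes.
Variables a b : R.
Hypotheses (ab : a < b) (sa : sin a = 0) (sb : sin b = 0).

Lemma wallis_cos1 n : wallis a b 1 n = 0.
Proof.
have := @wallis_deriv a b 0 n.+1 ab.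
rewrite sa sb !expr0n /= !mulr0 subrr mul0r subr0 => /eqP.
by rewrite mulf_eq0 pnatr_eq0 => /eqP.
Qed.

Lemma wallis_shift m n :
  m.+1%:R * wallis a b m n.+2 = n.+1%:R * wallis a b m.+2 n.
Proof.
have := @wallis_deriv a b m.+1 n.+1 ab.
by rewrite sa sb !expr0n /= !mulr0 subrr => /eqP; rewrite subr_eq0 => /eqP ->.
Qed.

Lemma wallis_cos m n :
  (m + n).+2%:R * wallis a b m.+2 n = m.+1%:R * wallis a b m n.
Proof.
rewrite [in RHS]wallis_pyth mulrDr wallis_shift -mulrDl -natrD.
by congr (_%:R * _); rewrite addSn addnS.
Qed.

Lemma wallis_sin m n :
  (m + n).+2%:R * wallis a b m n.+2 = n.+1%:R * wallis a b m n.
Proof.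
rewrite [in RHS]wallis_pyth mulrDr -wallis_shift -mulrDl -natrD.
by congr (_%:R * _); rewrite addSn addnS.
Qed.

(* Here it is the cosine that cancels the boundary terms; among the two ranges
   only [0, 2 pi] qualifies. *)
Lemma wallis_sin1 m : cos a = cos b -> wallis a b m 1 = 0.
Proof.
move=> cab; have := @wallis_deriv a b m.+1 0 ab.
rewrite !expr0 cab subrr mul0r sub0r => /eqP.
by rewrite oppr_eq0 mulf_eq0 pnatr_eq0 => /eqP.
Qed.

End SinVanishes.

Lemma wallis00 a b : a < b -> wallis a b 0 0 = b - a.
Proof.
move=> ab; rewrite /wallis -(@Rintegral_derive _ _ (cst 1) id ab) //.
  by apply: eq_Rintegral => x _; rewrite !expr0 mul1r.
by move=> x; exact: cvg_cst.
Qed.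

Lemma wallis01 a b : a < b -> wallis a b 0 1 = cos a - cos b.
Proof.
move=> ab; have := @wallis_deriv a b 1 0 ab.
by rewrite mul0r mul1r sub0r !expr0 !expr1 !mulr1 => /(canRL opprK); rewrite opprB.
Qed.

End Wallis.

(** * Moments of the unit sphere *)

Section Moments.
Variable R : realType.
Implicit Types (a b c d : nat) (m : multinom 4).

Local Notation W1 := (wallis (0 : R) pi).
Local Notation W2 := (wallis (0 : R) (2 * pi)).

Let pi0 : (0 : R) < pi. Proof. exact: pi_gt0. Qed.
Let pi20 : (0 : R) < 2 * pi. Proof. by rewrite mulr_gt0. Qed.
Let s0 : sin (0 : R) = 0. Proof. exact: sin0. Qed.
Let s1 : sin (pi : R) = 0. Proof. exact: sinpi. Qed.
Let s2 : sin (2 * pi : R) = 0. Proof. by rewrite mulr_natl sin2pi. Qed.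

(** The mean over the sphere of x_0^a x_1^b x_2^c x_3^d. In hyperspherical
    coordinates this monomial splits into a function of each angle, and the two
    extra powers of sin u and the extra power of sin v come from the area
    element. *)
Definition moment4 a b c d : R :=
  (2 * pi ^+ 2)^-1 * (W1 a (b + c + d).+2 * W1 b (c + d).+1 * W2 c d).

Lemma moment4_odd a b c d :
  [/\ moment4 1 b c d = 0, moment4 a 1 c d = 0, moment4 a b 1 d = 0
    & moment4 a b c 1 = 0].
Proof.
rewrite /moment4 !(wallis_cos1 pi0 s0 s1) (wallis_cos1 pi20 s0 s2).
rewrite (wallis_sin1 pi20); last by rewrite cos0 mulr_natl cos2pi.
by rewrite !(mul0r, mulr0).
Qed.

(** The telescoping in moment4_step: the numerator of the ratio by which each
    integral changes is the denominator of the next ratio. *)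
Lemma prod3_ratio (p q r t x y z x' y' z' : R) : q != 0 -> r != 0 ->
  p * x = q * x' -> q * y = r * y' -> r * z = t * z' ->
  p * (x * y * z) = t * (x' * y' * z').
Proof.
move=> q0 r0 hx hy hz; rewrite !mulrA hx.
rewrite [q * x' * y]mulrAC hy -[X in X * z]mulrA [r * _ * z]mulrAC hz.
by ring.
Qed.

(** Raising the exponent of x_0 by two only changes the integral in u. For a later
    coordinate the sine exponents of the earlier angles grow as well, and the
    ratios given by the Wallis recurrences telescope. *)
Lemma moment4_step a b c d (n := (a + b + c + d + 4)%:R : R) :
  [/\ n * moment4 a.+2 b c d = a.+1%:R * moment4 a b c d,
      n * moment4 a b.+2 c d = b.+1%:R * moment4 a b c d,
      n * moment4 a b c.+2 d = c.+1%:R * moment4 a b c d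
    & n * moment4 a b c d.+2 = d.+1%:R * moment4 a b c d].
Proof.
have step (t x y z x' y' z' q r : R) : q != 0 -> r != 0 ->
    n * x = q * x' -> q * y = r * y' -> r * z = t * z' ->
    n * ((2 * pi ^+ 2)^-1 * (x * y * z)) = t * ((2 * pi ^+ 2)^-1 * (x' * y' * z')).
  move=> q0 r0 hx hy hz; rewrite mulrCA (prod3_ratio q0 r0 hx hy hz); exact: mulrCA.
have nE : n = (a + (b + c + d).+2).+2%:R by congr _%:R; rewrite /n; lia.
rewrite /moment4; split; rewrite ?(addnS, addSn).
- apply: (@step _ _ _ _ _ _ _ a.+1%:R a.+1%:R); rewrite ?pnatr_eq0 //.
  by rewrite nE (wallis_cos pi0).
- apply: (@step _ _ _ _ _ _ _ (b + c + d).+3%:R b.+1%:R); rewrite ?pnatr_eq0 //.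
    by rewrite nE (wallis_sin pi0).
  by rewrite -(wallis_cos pi0) //; congr (_%:R * _); lia.
- apply: (@step _ _ _ _ _ _ _ (b + c + d).+3%:R (c + d).+2%:R); rewrite ?pnatr_eq0 //.
  + by rewrite nE (wallis_sin pi0).
  + by rewrite -(wallis_sin pi0) //; congr (_%:R * _); lia.
  + by rewrite (wallis_cos pi20).
- apply: (@step _ _ _ _ _ _ _ (b + c + d).+3%:R (c + d).+2%:R); rewrite ?pnatr_eq0 //.
  + by rewrite nE (wallis_sin pi0).
  + by rewrite -(wallis_sin pi0) //; congr (_%:R * _); lia.
  + by rewrite (wallis_sin pi20).
Qed.

Lemma moment4_0 : moment4 0 0 0 0 = 1.
Proof.
rewrite /moment4 !addn0 wallis00 // wallis01 // cos0 cospi subr0 opprK.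
have /(canRL (mulKf _)) -> // := wallis_sin pi0 s0 s1 0 0; rewrite ?pnatr_eq0 //.
rewrite wallis00 // subr0.
have p0 : (pi : R) != 0 by rewrite gt_eqF.
by rewrite addn0; move: (pi : R) p0 => p p0; field.
Qed.

Definition moment m : R :=
  moment4 (m (inord 0)) (m (inord 1)) (m (inord 2)) (m (inord 3)).

(** If x_i does not occur in the monomial m, then x_i m is odd in x_i and has mean
    0; otherwise this is the recurrence for moments. *)
Lemma moment_mulX (i : 'I_4) m :
  (mdeg m + 3)%:R * moment (mnm_add (mnm1 i) m)
    = (m i)%:R * moment (mnm_sub m (mnm1 i)).
Proof.
rewrite mdegE (@big_ord4 nat 0%N addn); move: i; apply: ord4_ind;
  rewrite /moment !mnmDE !mnmBE !mnm1E !inord4_eq //= ?add0n ?subn0 ?add1n;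
  move: (m (inord 0)) (m (inord 1)) (m (inord 2)) (m (inord 3)) => a b c d.
- case: a => [|a].
    by have [-> _ _ _] := moment4_odd 0 b c d; rewrite mulr0 mul0r.
  rewrite subn1 /=; have [<- _ _ _] := moment4_step a b c d.
  by congr (_%:R * _); lia.
- case: b => [|b].
    by have [_ -> _ _] := moment4_odd a 0 c d; rewrite mulr0 mul0r.
  rewrite subn1 /=; have [_ <- _ _] := moment4_step a b c d.
  by congr (_%:R * _); lia.
- case: c => [|c].
    by have [_ _ -> _] := moment4_odd a b 0 d; rewrite mulr0 mul0r.
  rewrite subn1 /=; have [_ _ <- _] := moment4_step a b c d.
  by congr (_%:R * _); lia.
- case: d => [|d].
    by have [_ _ _ ->] := moment4_odd a b c 0; rewrite mulr0 mul0r.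
  rewrite subn1 /=; have [_ _ _ <-] := moment4_step a b c d.
  by congr (_%:R * _); lia.
Qed.

End Moments.

(** * Sphere means of polynomials *)

Section SphereMean.
Variable R : realType.
Implicit Types (p q f g : mpoly 4 R) (m : multinom 4) (i : 'I_4) (x : quat R).

Lemma pevalD p q x : peval (p + q) x = peval p x + peval q x.
Proof. exact: mevalD. Qed.

Lemma pevalM p q x : peval (p * q) x = peval p x * peval q x.
Proof. exact: mevalM. Qed.

Lemma pevalZ (c : R) p x : peval (c *: p) x = c * peval p x.
Proof. exact: mevalZ. Qed.

Lemma peval1 x : peval 1 x = 1.
Proof. exact: meval1. Qed.

Lemma peval_sphere_pt m (u v w : R) :
  peval (mpolyX R m) (sphere_pt u v w)
  = (cos u ^+ m (inord 0) * sin u ^+ (m (inord 1) + m (inord 2) + m (inord 3))) *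
    (cos v ^+ m (inord 1) * sin v ^+ (m (inord 2) + m (inord 3))) *
    (cos w ^+ m (inord 2) * sin w ^+ m (inord 3)).
Proof.
rewrite /peval mevalX big_ord4 /= /sphere_pt !mxE !inordK //= !exprMn !exprD.
by ring.
Qed.

(** The iterated integral is linear on combinations of monomials because each
    inner integral is again a finite sum of products of continuous functions of
    the remaining angles. *)
Lemma sphere_mean_sum (I : Type) (s : seq I) (k : I -> R) (m : I -> multinom 4) :
  sphere_mean (fun y => \sum_(i <- s) k i * peval (mpolyX R (m i)) y)
    = \sum_(i <- s) k i * moment R (m i).
Proof.
pose A (i : I) (u : R) : R := cos u ^+ m i (inord 0) *
  sin u ^+ (m i (inord 1) + m i (inord 2) + m i (inord 3)).+2.
pose B (i : I) (v : R) : R := cos v ^+ m i (inord 1) *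
  sin v ^+ (m i (inord 2) + m i (inord 3)).+1.
pose C (i : I) (w : R) : R := cos w ^+ m i (inord 2) * sin w ^+ m i (inord 3).
have cA (i : I) : continuous (A i) by exact: continuous_cosX_sinX.
have cB (i : I) : continuous (B i) by exact: continuous_cosX_sinX.
have cC (i : I) : continuous (C i) by exact: continuous_cosX_sinX.
rewrite /sphere_mean.
under eq_Rintegral => u _.
  under eq_Rintegral => v _.
    under eq_Rintegral => w _.
      rewrite big_distrl /=.
      under eq_bigr => i _.
        have -> : k i * peval (mpolyX R (m i)) (sphere_pt u v w) *
          (sin u ^+ 2 * sin v) = (k i * A i u * B i v) * C i w.
          by rewrite peval_sphere_pt /A /B /C !exprS; ring.
        over.
      over.
    rewrite (Rintegral_sum_continuous _ _ _ _ cC).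
    under eq_bigr => i _.
      rewrite mulrAC.
      over.
    over.
  rewrite (Rintegral_sum_continuous _ _ _ _ cB).
  under eq_bigr => i _.
    rewrite -mulrA mulrAC.
    over.
  over.
rewrite (Rintegral_sum_continuous _ _ _ _ cA) big_distrr /=.
apply: eq_bigr => i _; rewrite /moment /moment4 /wallis.
rewrite -/(A i) -/(B i) -/(C i) -!mulrA mulrCA; congr (_ * (_ * _)).
by rewrite mulrCA [RHS]mulrCA; congr (_ * _); exact: mulrC.
Qed.

Lemma sphere_meanE p :
  sphere_mean (peval p) = \sum_(m <- msupp p) mcoeff m p * moment R m.
Proof.
rewrite -sphere_mean_sum; congr sphere_mean; apply/funext => y.
by rewrite {1}[p]mpolyE /peval raddf_sum; apply: eq_bigr => m _ /=; rewrite mevalZ.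
Qed.

Lemma sphere_meanX m : sphere_mean (peval (mpolyX R m)) = moment R m.
Proof.
transitivity (sphere_mean (fun y => \sum_(i <- [:: m]) 1 * peval (mpolyX R i) y)).
  by congr sphere_mean; apply/funext => y; rewrite big_seq1 mul1r.
by rewrite (sphere_mean_sum _ _ id) big_seq1 mul1r.
Qed.

Lemma sphere_mean_linear (c : R) p q :
  sphere_mean (peval (c *: p + q)) = c * sphere_mean (peval p) + sphere_mean (peval q).
Proof.
rewrite !sphere_meanE.
pose cp m := (c * mcoeff m p, m); pose cq m := (mcoeff m q, m).
pose s := [seq cp m | m <- msupp p] ++ [seq cq m | m <- msupp q].
transitivity (\sum_(i <- s) i.1 * moment R i.2); last first.
  rewrite big_cat /= (big_map cp) (big_map cq) big_distrr /=; congr (_ + _).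
  by apply: eq_bigr => m _; rewrite -mulrA.
rewrite -(sphere_mean_sum s fst snd) -sphere_meanE; congr sphere_mean.
apply/funext => y; rewrite big_cat /= (big_map cp) (big_map cq) pevalD pevalZ.
rewrite {1}[p]mpolyE {1}[q]mpolyE /peval !raddf_sum big_distrr /=.
by congr (_ + _); apply: eq_bigr => m _; rewrite mevalZ ?mulrA.
Qed.

Lemma sphere_meanD p q :
  sphere_mean (peval (p + q)) = sphere_mean (peval p) + sphere_mean (peval q).
Proof. by have := sphere_mean_linear 1 p q; rewrite scale1r mul1r. Qed.

Lemma sphere_mean0 : sphere_mean (peval (0 : mpoly 4 R)) = 0.
Proof. by rewrite sphere_meanE msupp0 big_nil. Qed.

Lemma sphere_meanZ (c : R) p :
  sphere_mean (peval (c *: p)) = c * sphere_mean (peval p).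
Proof. by rewrite -[c *: p]addr0 sphere_mean_linear sphere_mean0 addr0. Qed.

Lemma sphere_mean_psum (I : Type) (s : seq I) (F : I -> mpoly 4 R) :
  sphere_mean (peval (\sum_(i <- s) F i)) = \sum_(i <- s) sphere_mean (peval (F i)).
Proof.
by apply: (big_ind2 (fun p r => sphere_mean (peval p) = r));
  [exact: sphere_mean0|move=> p r q t <- <-; exact: sphere_meanD|].
Qed.

Lemma sphere_mean1 : sphere_mean (peval (1 : mpoly 4 R)) = 1.
Proof.
by rewrite -(mpolyX0 4 R) sphere_meanX /moment !mnm0E moment4_0.
Qed.

(** The divergence theorem for the field f e_i in the unit ball, integrated along
    rays: d_i f has degree d - 1 and the space has dimension 4, whence the factor
    d + 3. *)
Lemma sphere_mean_mulX d i p : p \is ishomog1 d mdeg ->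
  (d + 3)%:R * sphere_mean (peval (mpolyX R (mnm1 i) * p))
    = sphere_mean (peval (mderiv i p)).
Proof.
move=> /dhomogP hp; rewrite {1 2}[p]mpolyE big_distrr raddf_sum.
rewrite !sphere_mean_psum big_distrr /= big_seq [RHS]big_seq.
apply: eq_bigr => m /hp <-; rewrite -[mpolyX _ _ * _]scalerAr mderivZ mderivX -mpolyXD.
by rewrite !sphere_meanZ !sphere_meanX [LHS]mulrCA moment_mulX.
Qed.

End SphereMean.

(** * Derivatives and Laplacians of polynomial functions *)

Section PolynomialCalculus.
Variable R : realType.
Implicit Types (p q : mpoly 4 R) (i j : 'I_4) (x y v : quat R).

Local Notation "''X_' i" := (mpolyX R (mnm1 i)) (at level 8, i at level 2, format "''X_' i").

(** Polynomial functions can then be differentiated by the sum and product rules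
    alone. *)
Lemma mpoly_ring_ind (P : mpoly 4 R -> Prop) :
  (forall c, P (mpolyC 4 c)) -> (forall i, P 'X_i) ->
  (forall p q, P p -> P q -> P (p + q)) ->
  (forall p q, P p -> P q -> P (p * q)) -> forall p, P p.
Proof.
move=> PC PX PD PM p; rewrite [p]mpolyE.
apply: (big_ind P _ PD) => [|m _]; first by rewrite -(mpolyC0 4 R).
rewrite -mul_mpolyC; apply: (PM) => //; rewrite mpolyXE_id.
apply: (big_ind P _ PM) => [|i _]; first by rewrite -(mpolyC1 4 R).
by elim: (m i) => [|n IHn]; rewrite ?expr0 -?(mpolyC1 4 R) // exprS; exact: PM.
Qed.

Lemma is_derive_coord x v j :
  is_derive x v (fun y : quat R => y ord0 j) (v ord0 j).
Proof.
have [did did'] := @is_derive_id R (quat R) x v.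
have dj := (derivable_mxP id x v).1 did ord0 j.
apply: DeriveDef => //; rewrite -[in RHS]did'.
by rewrite (derive_mx did) mxE.
Qed.

Lemma qbaseE i j : @qbase R i ord0 j = (i == j)%:R.
Proof.
by move: i j; apply: ord4_ind; apply: ord4_ind;
   rewrite /qbase inordK //= !mxE !inordK //= inord4_eq.
Qed.

Lemma peval_is_derive p i x :
  is_derive x (qbase R i) (peval p) (peval (mderiv i p) x).
Proof.
move: p; apply: mpoly_ring_ind => [c|j|p q dp dq|p q dp dq].
- rewrite mderivC /peval raddf0.
  have -> : (fun x : quat R => meval [eta x ord0] (mpolyC 4 c)) = cst c.
    by apply/funext => y; rewrite mevalC.
  exact: is_derive_cst.
- have -> : peval 'X_j = (fun y : quat R => y ord0 j).
    by apply/funext => y; rewrite /peval mevalXU.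
  apply: (is_derive_eq (is_derive_coord x (qbase R i) j)).
  rewrite qbaseE mderivX mnm1E pevalZ.
  have [->|nij] := eqVneq j i; last by rewrite mul0r.
  by rewrite mul1r -{1}(add0m (mnm1 i)) addmK mpolyX0 peval1.
- have -> : peval (p + q) = peval p + peval q by apply/funext => y; exact: pevalD.
  by rewrite mderivD pevalD; exact: is_deriveD.
- have -> : peval (p * q) = peval p * peval q by apply/funext => y; exact: pevalM.
  apply: (is_derive_eq (is_deriveM dp dq)).
  by rewrite mderivM pevalD !pevalM /GRing.scale /= addrC mulrC.
Qed.

Lemma derive_peval p i :
  'D_(qbase R i) (peval p : quat R -> R^o) = peval (mderiv i p).
Proof. by apply/funext => x; have [_ e] := peval_is_derive p i x; exact: e. Qed.

Lemma derivable_peval p i x :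
  derivable (peval p : quat R -> R^o) x (qbase R i).
Proof. by have [] := peval_is_derive p i x. Qed.

Lemma continuous_peval p : continuous (peval p : quat R -> R^o).
Proof.
move: p; apply: mpoly_ring_ind => [c|j|p q cp cq|p q cp cq] x.
- have -> : peval (mpolyC 4 c) = cst c by apply/funext => y; exact: mevalC.
  exact: cst_continuous.
- have -> : peval 'X_j = (fun y : quat R => y ord0 j).
    by apply/funext => y; rewrite /peval mevalXU.
  exact: coord_continuous.
- have -> : peval (p + q) = peval p + peval q by apply/funext => y; exact: pevalD.
  exact: continuousD (cp x) (cq x).
- have -> : peval (p * q) = peval p * peval q by apply/funext => y; exact: pevalM.
  exact: continuousM (cp x) (cq x).
Qed.

Definition mlap p : mpoly 4 R := \sum_(i < 4) mderiv i (mderiv i p).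

Lemma peval_laplacian p x :
  laplacian (peval p : quat R -> R^o) x = peval (mlap p) x.
Proof.
rewrite /laplacian /mlap /peval raddf_sum; apply: eq_bigr => i _.
rewrite -/(peval p) derive_peval.
by have [_ e] := peval_is_derive (mderiv i p) i x; exact: e.
Qed.

(** Harmonicity as an identity between values of polynomials, free of limits. *)
Lemma homog_harmonicP m p : homog_harmonic m p <->
  p \is ishomog1 m mdeg /\ forall x, peval (mlap p) x = 0.
Proof.
split=> [[hp [_ _ lp]]|[hp lp]]; split=> //.
  by move=> x; rewrite -peval_laplacian lp.
split; first exact: openT.
- move=> x _; split=> [|i]; first exact: continuous_peval.
  rewrite derive_peval; split; first exact: derivable_peval.
    exact: continuous_peval.
  move=> n; rewrite derive_peval; split; first exact: derivable_peval.
  exact: continuous_peval.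
- by move=> x _; rewrite peval_laplacian.
Qed.

Lemma dhomog_mderiv m p i :
  p \is ishomog1 m.+1 mdeg -> mderiv i p \is ishomog1 m mdeg.
Proof.
move=> /dhomogP hp; apply/dhomogP => n; rewrite mcoeff_msupp mcoeff_mderiv.
have [|/memN_msupp_eq0 ->] := boolP (mnm_add n (mnm1 i) \in msupp p).
  by move/hp => /=; rewrite mdegD mdeg1 addn1 => -[].
by rewrite mul0rn eqxx.
Qed.

Lemma homog_harmonic_mderiv m p i :
  homog_harmonic m.+1 p -> homog_harmonic m (mderiv i p).
Proof.
move=> /homog_harmonicP[hp lp]; apply/homog_harmonicP.
split=> [|x]; first exact: dhomog_mderiv.
have -> : mlap (mderiv i p) = mderiv i (mlap p).
  by rewrite /mlap raddf_sum; apply: eq_bigr => j _; rewrite !(mderiv_comm i).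
rewrite -derive_peval.
have -> : peval (mlap p) = cst 0 by apply/funext => y; exact: lp.
exact: derive_cst.
Qed.

Lemma euler_homog m p : p \is ishomog1 m mdeg ->
  \sum_(i < 4) 'X_i * mderiv i p = m%:R *: p.
Proof.
move=> /dhomogP hp.
transitivity (\sum_(n <- msupp p) mcoeff n p *: \sum_(i < 4) 'X_i * mderiv i (mpolyX R n)).
  under [RHS]eq_bigr do rewrite scaler_sumr.
  rewrite [RHS]exchange_big /=; apply: eq_bigr => i _.
  rewrite {1}[p]mpolyE raddf_sum big_distrr /=; apply: eq_bigr => n _.
  by rewrite mderivZ scalerAr.
rewrite [in RHS](mpolyE p) scaler_sumr big_seq [RHS]big_seq.
apply: eq_bigr => n /hp <-; rewrite scalerA mulrC -scalerA; congr (_ *: _).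
rewrite /= mdegE natr_sum scaler_suml; apply: eq_bigr => i _.
rewrite mderivX -scalerAr -mpolyXD addmC.
have [->|ni0] := eqVneq (n i) 0%N; first by rewrite !scale0r.
by rewrite submK // lep1mP.
Qed.

Lemma peval_homogZ m p (c : R) x : p \is ishomog1 m mdeg ->
  peval p (c *: x) = c ^+ m * peval p x.
Proof.
move=> /dhomogP hp; rewrite /peval !mevalE big_distrr /= big_seq [RHS]big_seq.
apply: eq_bigr => n /hp <-; rewrite mulrCA; congr (_ * _).
under eq_bigr do rewrite mxE exprMn.
by rewrite big_split /= mdegE expr_sum.
Qed.

End PolynomialCalculus.

(** * Zonal harmonics *)

Section Zonal.
Variable R : realType.
Implicit Types (p q : mpoly 4 R) (i j : 'I_4) (a x y v : quat R).

Local Notation "''X_' i" := (mpolyX R (mnm1 i)) (at level 8, i at level 2, format "''X_' i").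

Definition qdot a x : R := \sum_(i < 4) a ord0 i * x ord0 i.

Definition linpoly a : mpoly 4 R := \sum_(i < 4) a ord0 i *: 'X_i.

Definition normpoly : mpoly 4 R := \sum_(i < 4) 'X_i ^+ 2.

Lemma qnorm2E x : qnorm2 x = \sum_(i < 4) x ord0 i ^+ 2.
Proof. by rewrite big_ord4. Qed.

Lemma peval_linpoly a x : peval (linpoly a) x = qdot a x.
Proof.
rewrite /peval raddf_sum; apply: eq_bigr => i _ /=.
by rewrite mevalZ mevalXU.
Qed.

Lemma peval_normpoly x : peval normpoly x = qnorm2 x.
Proof.
rewrite /peval raddf_sum qnorm2E; apply: eq_bigr => i _ /=.
by rewrite rmorphXn /= mevalXU.
Qed.

Lemma mderivXU i j : mderiv i 'X_j = (i == j)%:R :> mpoly 4 R.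
Proof.
rewrite mderivX mnm1E eq_sym.
have [->|nij] := eqVneq i j; last by rewrite scale0r.
by rewrite scale1r -{1}(add0m (mnm1 j)) addmK mpolyX0.
Qed.

Lemma sum_delta (V : lmodType R) (F : 'I_4 -> V) i :
  \sum_(j < 4) (i == j)%:R *: F j = F i.
Proof.
rewrite (bigD1 i) //= eqxx scale1r big1 ?addr0 // => j.
by rewrite eq_sym => /negbTE ->; rewrite scale0r.
Qed.

Lemma mderiv_linpoly a i : mderiv i (linpoly a) = (a ord0 i)%:A.
Proof.
rewrite raddf_sum /= -(sum_delta (fun j => (a ord0 j)%:A)); apply: eq_bigr => j _.
rewrite mderivZ mderivXU scalerA mulrC -scalerA.
by case: (i == j); rewrite ?scale1r ?scale0r ?scaler0.
Qed.

Lemma mderiv_normpoly i : mderiv i normpoly = 2 *: 'X_i.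
Proof.
rewrite raddf_sum /= -(sum_delta (fun j => 2 *: 'X_j)); apply: eq_bigr => j _.
rewrite expr2 mderivM mderivXU.
case: (i == j); last by rewrite scale0r mul0r mulr0 addr0.
by rewrite scale1r mul1r mulr1 scaler_nat mulr2n.
Qed.

Lemma mderiv_linpolyX a i n :
  mderiv i (linpoly a ^+ n.+1) = (n.+1%:R * a ord0 i) *: linpoly a ^+ n.
Proof.
elim: n => [|n IHn]; first by rewrite expr1 expr0 mul1r mderiv_linpoly.
rewrite exprS mderivM IHn mderiv_linpoly -scalerAl mul1r -scalerAr -exprS -scalerDl.
by congr (_ *: _); rewrite -[n.+2]add1n natrD; ring.
Qed.

Lemma dhomog_linpoly a : linpoly a \is ishomog1 1 mdeg.
Proof. by apply: rpred_sum => i _; apply: rpredZ; rewrite dhomogX /= mdeg1. Qed.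

Lemma dhomog_normpoly : normpoly \is ishomog1 2 mdeg.
Proof.
apply: rpred_sum => i _; rewrite expr2.
by rewrite (@dhomogM _ _ mdeg 1 _ 1) // dhomogX /= mdeg1.
Qed.

(** Zonal harmonics are found by testing a harmonic p of degree m against powers
    of the linear form a . x. By Euler's identity m p = sum_i x_i (d_i p); the
    divergence theorem then moves a derivative d_i onto (d_i p) (a . x)^n, where
    the Laplacian of p appears and vanishes. What is left is the same problem for
    the d_i p, of degree m - 1, and the exponent n - 1. *)
Lemma mean_homog_harmonic_linpolyX a m p n : homog_harmonic m p -> (n <= m)%N ->
  sphere_mean (peval (p * linpoly a ^+ n))
    = if n == m then peval p a / (2 ^+ m * m.+1%:R) else 0.
Proof.
elim: m p n => [|m IHm] p n hp.
  rewrite leqn0 => /eqP ->; rewrite eqxx !expr0 mulr1 mul1r divr1.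
  have [/dhomogP h0 _] := hp.
  have -> : p = mcoeff mnm0 p *: 1.
    apply/mpolyP => k; rewrite mcoeffZ mcoeff1.
    have [->|k0] := eqVneq k mnm0; first by rewrite mulr1.
    rewrite mulr0; apply/memN_msupp_eq0/negP => /h0 /eqP.
    by rewrite /= mdeg_eq0 (negbTE k0).
  by rewrite sphere_meanZ sphere_mean1 pevalZ peval1.
move=> nm; have [hd /homog_harmonicP[_ lp]] := (hp.1, hp).
have hdi i := homog_harmonic_mderiv i hp.
(* m + 1 comes from Euler's identity and m + n + 3 from the divergence theorem,
   applied to a polynomial of degree m + n. *)
apply: (@mulfI _ (m.+1%:R * (m + n + 3)%:R));
  first by rewrite mulf_neq0 ?pnatr_eq0 ?addn3.
have -> : m.+1%:R * (m + n + 3)%:R * sphere_mean (peval (p * linpoly a ^+ n))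
  = \sum_(i < 4) sphere_mean (peval (mderiv i (mderiv i p * linpoly a ^+ n))).
  rewrite mulrAC -sphere_meanZ scalerAl -(euler_homog hd) mulrC big_distrl /=.
  rewrite sphere_mean_psum big_distrr /=; apply: eq_bigr => i _.
  rewrite -mulrA sphere_mean_mulX //; apply: dhomogM; first exact: (hdi i).1.
  by rewrite -[n in ishomog1 n]mul1n; apply: dhomogMn; exact: dhomog_linpoly.
have lap0 q : sphere_mean (peval (mlap p * q)) = 0.
  rewrite -[RHS](sphere_mean0 R); congr sphere_mean; apply/funext => x.
  by rewrite pevalM lp mul0r /peval raddf0.
case: n nm => [|n] nm.
  rewrite expr0; under eq_bigr do rewrite mulr1.
  by rewrite -sphere_mean_psum -[X in peval X]mulr1 lap0 mulr0.
under eq_bigr => i _.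
  rewrite mderivM mderiv_linpolyX sphere_meanD -scalerAr sphere_meanZ (IHm _ _ (hdi i)) //.
  over.
rewrite big_split /= -sphere_mean_psum -big_distrl /= lap0 add0r eqSS.
case: eqP => [->|_]; last by rewrite mulr0 big1 // => i _; rewrite mulr0.
have := congr1 (fun q => peval q a) (euler_homog hd); rewrite pevalZ.
have -> : peval (\sum_(i < 4) 'X_i * mderiv i p) a
    = \sum_(i < 4) a ord0 i * peval (mderiv i p) a.
  rewrite /peval raddf_sum; apply: eq_bigr => i _ /=.
  by rewrite mevalM mevalXU.
move=> e; under eq_bigr do rewrite -mulrA [X in _ * X]mulrA.
rewrite -big_distrr -big_distrl /= e addn3.
have m1 : (m.+1%:R : R) != 0 by rewrite pnatr_eq0.
have m2 : (m.+2%:R : R) != 0 by rewrite pnatr_eq0.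
have -> : (m + m.+1).+3%:R = 2 * m.+2%:R :> R by rewrite -natrM; congr _%:R; lia.
rewrite exprS; field.
by rewrite -(natrD _ 2 m) -(natrD _ 1 m) expf_neq0 ?pnatr_eq0.
Qed.

(** The homogenized Chebyshev polynomial of the second kind, |x|^n U_n(a . x / |x|)
    when a is a unit vector: its recurrence is that of U_n, made homogeneous. *)
Fixpoint zpoly a n : mpoly 4 R :=
  match n with
  | 0%N => 1
  | 1%N => 2 *: linpoly a
  | (n'.+1 as n1).+1 => 2 *: (linpoly a * zpoly a n1) - normpoly * zpoly a n'
  end.

Arguments zpoly : simpl never.

Lemma zpoly0 a : zpoly a 0 = 1. Proof. by []. Qed.

Lemma zpoly1 a : zpoly a 1 = 2 *: linpoly a. Proof. by []. Qed.

Lemma zpolySS a n :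
  zpoly a n.+2 = 2 *: (linpoly a * zpoly a n.+1) - normpoly * zpoly a n.
Proof. by []. Qed.

Lemma dhomog_zpoly a n : zpoly a n \is ishomog1 n mdeg.
Proof.
elim/nat_ind2: n => [|| n hn hn1]; first exact: dhomog1.
  exact/rpredZ/dhomog_linpoly.
rewrite zpolySS; apply: rpredB.
  by apply: rpredZ; rewrite -[n.+2]add1n; apply: dhomogM => //; exact: dhomog_linpoly.
by rewrite -[n.+2]add2n; apply: dhomogM => //; exact: dhomog_normpoly.
Qed.

Lemma mlapM p q :
  mlap (p * q) = mlap p * q + 2 *: (\sum_(i < 4) mderiv i p * mderiv i q) + p * mlap q.
Proof.
rewrite /mlap scaler_sumr big_distrl big_distrr -!big_split /=.
apply: eq_bigr => i _; rewrite !mderivM !mderivD !mderivM.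
by rewrite scaler_nat mulr2n !addrA.
Qed.

Definition mderiv_along a p : mpoly 4 R := \sum_(i < 4) a ord0 i *: mderiv i p.

Lemma mderiv_along_linear a : linear (mderiv_along a).
Proof.
move=> c p q; rewrite /mderiv_along scaler_sumr -big_split /=.
apply: eq_bigr => i _; rewrite mderivD mderivZ scalerDr.
by rewrite !scalerA mulrC.
Qed.

HB.instance Definition _ a := GRing.isLinear.Build R (mpoly 4 R) (mpoly 4 R) _
  (mderiv_along a) (mderiv_along_linear a).

Lemma mderiv_alongM a p q :
  mderiv_along a (p * q) = mderiv_along a p * q + p * mderiv_along a q.
Proof.
rewrite /mderiv_along big_distrl big_distrr -big_split /=.
by apply: eq_bigr => i _; rewrite mderivM scalerDr -scalerAl -scalerAr.
Qed.

Lemma mderiv_along_normpoly a : mderiv_along a normpoly = 2 *: linpoly a.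
Proof.
rewrite /mderiv_along /linpoly scaler_sumr; apply: eq_bigr => i _.
by rewrite mderiv_normpoly !scalerA mulrC.
Qed.

Lemma scaler_natE n p : n%:R *: p = n%:R * p.
Proof. by rewrite scaler_nat mulr_natl. Qed.

Lemma homog_harmonicZ (c : R) m p : homog_harmonic m p -> homog_harmonic m (c *: p).
Proof.
move=> /homog_harmonicP[hp lp]; apply/homog_harmonicP; split=> [|x]; first exact: rpredZ.
have -> : mlap (c *: p) = c *: mlap p.
  by rewrite /mlap scaler_sumr; apply: eq_bigr => i _; rewrite !mderivZ.
by rewrite pevalZ lp mulr0.
Qed.

Section UnitPole.
Variable a : quat R.
Hypothesis a1 : qnorm2 a = 1.

Lemma mderiv_along_linpoly : mderiv_along a (linpoly a) = 1.
Proof.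
rewrite -[RHS]scale1r -a1 qnorm2E scaler_suml; apply: eq_bigr => i _.
by rewrite mderiv_linpoly scalerA.
Qed.

(** The unit length of a enters as the derivative of a . x along a, equal to |a|^2.
    The relation is what makes zpoly a n harmonic. *)
Lemma mderiv_along_zpoly n : mderiv_along a (zpoly a n.+1) = n.+2%:R *: zpoly a n.
Proof.
elim/nat_ind2: n => [||n IHn IHn1].
- by rewrite zpoly1 linearZ /= mderiv_along_linpoly.
- rewrite zpolySS zpoly0 zpoly1 mulr1 linearB !linearZ /= mderiv_alongM linearZ /=.
  rewrite mderiv_along_linpoly mderiv_along_normpoly.
  rewrite !scaler_natE; ring.
- rewrite zpolySS linearB linearZ /= !mderiv_alongM IHn IHn1.
  rewrite mderiv_along_linpoly mderiv_along_normpoly.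
  rewrite [zpoly a n.+2]zpolySS !scaler_natE; ring.
Qed.

(** The Laplacian of (a . x) q brings in the derivative of q along a, and that of
    |x|^2 q brings in Euler's identity; for consecutive polynomials of the family
    the two contributions cancel. *)
Lemma mlap_zpoly n : mlap (zpoly a n) = 0.
Proof.
have lapT : mlap (linpoly a) = 0.
  by rewrite /mlap big1 // => i _; rewrite mderiv_linpoly mderivZ mderivC scaler0.
have lapN : mlap normpoly = 8%:R.
  rewrite /mlap (eq_bigr (fun=> 2 *: 1)).
    by rewrite sumr_const card_ord scaler_nat -mulrnA.
  by move=> i _; rewrite mderiv_normpoly mderivZ mderivXU eqxx.
elim/nat_ind2: n => [||n IHn IHn1].
- by rewrite /mlap big1 // => i _; rewrite zpoly0 -(mpolyC1 4 R) !mderivC ?mderiv0.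
- rewrite zpoly1 /mlap; under eq_bigr do rewrite !mderivZ.
  by rewrite -scaler_sumr -/(mlap _) lapT scaler0.
have lin c p q : mlap (c *: p - q) = c *: mlap p - mlap q.
  rewrite /mlap scaler_sumr -sumrB; apply: eq_bigr => i _.
  by rewrite !mderivB !mderivZ.
rewrite zpolySS lin !mlapM lapT lapN IHn IHn1 mul0r !mulr0 add0r !addr0.
have -> : \sum_(i < 4) mderiv i (linpoly a) * mderiv i (zpoly a n.+1)
    = n.+2%:R *: zpoly a n.
  rewrite -mderiv_along_zpoly; apply: eq_bigr => i _.
  by rewrite mderiv_linpoly -scalerAl mul1r.
have -> : \sum_(i < 4) mderiv i normpoly * mderiv i (zpoly a n)
    = (2 * n%:R) *: zpoly a n.
  rewrite -scalerA -(euler_homog (dhomog_zpoly a n)) scaler_sumr; apply: eq_bigr => i _.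
  by rewrite mderiv_normpoly -scalerAl.
rewrite -natrM !scaler_natE; ring.
Qed.

Lemma homog_harmonic_zpoly n : homog_harmonic n (zpoly a n).
Proof.
apply/homog_harmonicP; split=> [|x]; first exact: dhomog_zpoly.
by rewrite mlap_zpoly /peval raddf0.
Qed.

End UnitPole.

Lemma qnorm2_sphere_pt (u v w : R) : qnorm2 (sphere_pt u v w) = 1.
Proof.
by rewrite /qnorm2 /sphere_pt !qcoordE //= !exprMn !sin2cos2; ring.
Qed.

Lemma eq_sphere_mean (f g : quat R -> R) :
  (forall x, qnorm2 x = 1 -> f x = g x) -> sphere_mean f = sphere_mean g.
Proof.
move=> fg; rewrite /sphere_mean.
under eq_Rintegral => u _.
  under eq_Rintegral => v _.
    under eq_Rintegral => w _.
      rewrite fg; last exact: qnorm2_sphere_pt.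
      over.
    over.
  over.
by [].
Qed.

(** Unfolding the recurrence leaves only the leading term 2^k (a . x)^k, since all
    the lower powers of a . x are orthogonal to p and |x|^2 = 1 on the sphere. The
    extra factor (a . x)^n makes the induction on k go through. *)
Lemma mean_homog_harmonic_zpoly a m p n k : homog_harmonic m p -> (n + k <= m)%N ->
  sphere_mean (peval (p * (linpoly a ^+ n * zpoly a k)))
    = if (n + k == m)%N then peval p a / (2 ^+ n * m.+1%:R) else 0.
Proof.
move=> hp; elim/nat_ind2: k n => [n|n|k IHk IHk1 n] nk.
- move: nk; rewrite addn0 => nk; rewrite zpoly0 mulr1 (mean_homog_harmonic_linpolyX _ hp nk).
  by case: eqP => [->|].
- move: nk; rewrite addn1 => nk; rewrite zpoly1 -scalerAr -exprSr -scalerAr sphere_meanZ.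
  rewrite (mean_homog_harmonic_linpolyX _ hp nk).
  case: eqP => [<-|_]; last by rewrite mulr0.
  rewrite exprS; field.
  by rewrite -(natrD _ 2 n) expf_neq0 ?pnatr_eq0.
have -> : linpoly a ^+ n * zpoly a k.+2 = 2 *: (linpoly a ^+ n.+1 * zpoly a k.+1)
   - normpoly * (linpoly a ^+ n * zpoly a k).
  rewrite zpolySS mulrBr -scalerAr exprSr -!mulrA; congr (_ - _); exact: mulrCA.
rewrite mulrBr -scalerAr -[- _]scaleN1r addrC sphere_mean_linear sphere_meanZ.
have -> : sphere_mean (peval (p * (normpoly * (linpoly a ^+ n * zpoly a k))))
   = sphere_mean (peval (p * (linpoly a ^+ n * zpoly a k))).
  by apply: eq_sphere_mean => x x1; rewrite !pevalM peval_normpoly x1 mul1r.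
rewrite IHk ?IHk1; try lia.
have -> : (n + k == m)%N = false by apply/eqP; lia.
have -> : (n.+1 + k.+1 == m)%N = (n + k.+2 == m)%N by apply/eqP/eqP; lia.
rewrite mulr0 add0r; case: eqP => // _; last exact: mulr0.
rewrite exprS; field.
by rewrite -(natrD _ 1 m) expf_neq0 ?pnatr_eq0.
Qed.

Lemma unit_sphereE x : unit_sphere x <-> qnorm2 x = 1.
Proof.
rewrite /unit_sphere /= /qabs; split=> [e|->]; last exact: sqrtr1.
have := congr1 (fun t => t ^+ 2) e; rewrite expr1n sqr_sqrtr //.
by rewrite /qnorm2 !addr_ge0 ?sqr_ge0.
Qed.

Lemma is_zonal_zpoly a m : unit_sphere a -> is_zonal m a (m.+1%:R *: zpoly a m).
Proof.
move=> /unit_sphereE a1; split; first exact/homog_harmonicZ/homog_harmonic_zpoly.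
move=> p hp.
transitivity (sphere_mean (peval (m.+1%:R *: (p * (linpoly a ^+ 0 * zpoly a m))))).
  rewrite sphere_meanZ (mean_homog_harmonic_zpoly _ hp) // eqxx expr0 mul1r.
  by field; rewrite -(natrD _ 1 m) pnatr_eq0.
by congr sphere_mean; apply/funext => x; rewrite expr0 mul1r pevalZ !pevalM pevalZ mulrCA.
Qed.

Lemma unit_sphere1 : unit_sphere (1 : quat R).
Proof.
by apply/unit_sphereE; rewrite /qnorm2 qoneE !qcoordE //= expr1n expr0n /= !addr0.
Qed.

Lemma scaled_unit x : exists2 y, unit_sphere y & exists c : R, x = c *: y.
Proof.
have [->|x0] := eqVneq x 0.
  by exists 1; [exact: unit_sphere1|exists 0; rewrite scale0r].
have n0 : 0 < qnorm2 x.
  by rewrite lt_def qnorm2_eq0 x0 /= /qnorm2 !addr_ge0 ?sqr_ge0.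
have a0 : qabs x != 0 by rewrite gt_eqF // sqrtr_gt0.
exists ((qabs x)^-1 *: x); last by exists (qabs x); rewrite scalerA divff // scale1r.
apply/unit_sphereE; rewrite /qnorm2 !qcoordZ !exprMn -!mulrDr -/(qnorm2 x).
by rewrite exprVn sqr_sqrtr ?mulVf ?gt_eqF // ltW.
Qed.

(** The kernel zpoly y m reproduces Z at y, and Z reproduces zpoly y m at a: comparing
    the two gives the value of Z at y. Homogeneity extends it off the sphere. *)
Lemma is_zonal_unique a m Z x : unit_sphere a -> is_zonal m a Z ->
  peval Z x = m.+1%:R * peval (zpoly a m) x.
Proof.
move=> a1 [hZ repZ].
have on_sphere y : unit_sphere y -> peval Z y = m.+1%:R * peval (zpoly y m) a.
  move=> y1; have [hy repy] := is_zonal_zpoly m y1.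
  rewrite (repy _ hZ) -pevalZ (repZ _ hy); congr sphere_mean.
  by apply/funext => z; exact: mulrC.
have zpoly_sym y : unit_sphere y -> peval (zpoly y m) a = peval (zpoly a m) y.
  move=> /unit_sphereE y1; move: (a1) => /unit_sphereE a1'.
  elim/nat_ind2: m {hZ repZ on_sphere} => [||n IHn IHn1].
  - by rewrite !zpoly0 !peval1.
  - rewrite !zpoly1 !pevalZ !peval_linpoly; congr (_ * _).
    by apply: eq_bigr => i _; exact: mulrC.
  - have pevalB p q z : peval (p - q) z = peval p z - peval q z by exact: mevalB.
    rewrite !zpolySS !pevalB !pevalZ !pevalM !peval_linpoly !peval_normpoly.
    rewrite IHn IHn1 a1' y1; congr (_ * (_ * _) - _).
    by apply: eq_bigr => i _; exact: mulrC.
have [y y1 [c ->]] := scaled_unit x.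
rewrite (peval_homogZ _ _ hZ.1) (peval_homogZ _ _ (dhomog_zpoly a m)).
by rewrite on_sphere // zpoly_sym // mulrCA.
Qed.

Lemma zonalE a m x : unit_sphere a -> zonal m x a = m.+1%:R * peval (zpoly a m) x.
Proof.
move=> a1; apply: is_zonal_unique => //.
by apply: xgetPex; exists (m.+1%:R *: zpoly a m); exact: is_zonal_zpoly.
Qed.

End Zonal.

(** * Powers of a quaternion *)

Section QuaternionAlgebra.
Variable R : realType.
Implicit Types (x y z a v : quat R) (c : R).

Let qE := (@qcoordD R, @qcoordN R, @qcoordZ R, @qcoord0 R, @qcoordE R).

Ltac quat_ring := apply: quatP => -[|[|[|[|//]]]] _;
  rewrite ?(qmulE, qoneE) /qmul /qi /qj /qk /qconj /qim /qre /qnorm2 !qE //=; ring.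

Lemma qconjM x y : qconj (x * y) = qconj y * qconj x.
Proof. by quat_ring. Qed.

Lemma qconjK x : qconj (qconj x) = x.
Proof. by quat_ring. Qed.

Lemma qconj1 : qconj 1 = 1 :> quat R.
Proof. by quat_ring. Qed.

Lemma qconjX x n : qconj (x ^+ n) = qconj x ^+ n.
Proof.
by elim: n => [|n IHn]; rewrite ?qconj1 // exprS qconjM IHn -exprSr.
Qed.

Lemma qconjB x y : qconj (x - y) = qconj x - qconj y.
Proof. by quat_ring. Qed.

Lemma mulq_conj x : x * qconj x = (qnorm2 x)%:A.
Proof. by quat_ring. Qed.

Lemma addq_conj x : x + qconj x = (2 * qre x)%:A.
Proof. by quat_ring. Qed.

Lemma subq_conj x : x - qconj x = 2 *: qim x.
Proof. by quat_ring. Qed.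

Lemma qre_conj x : qre (qconj x) = qre x.
Proof. by rewrite /qre /qconj !qE. Qed.

Lemma qnorm2_conj x : qnorm2 (qconj x) = qnorm2 x.
Proof. by rewrite /qnorm2 /qconj !qE //= !sqrrN. Qed.

Lemma qnorm2M x y : qnorm2 (x * y) = qnorm2 x * qnorm2 y.
Proof. by rewrite qmulE /qmul /qnorm2 !qE //=; ring. Qed.

Lemma qnorm2_ge0 x : 0 <= qnorm2 x.
Proof. by rewrite /qnorm2 !addr_ge0 ?sqr_ge0. Qed.

Lemma qabs2 x : qabs x ^+ 2 = qnorm2 x.
Proof. by rewrite sqr_sqrtr // qnorm2_ge0. Qed.

Lemma mulconj_q x : qconj x * x = (qnorm2 x)%:A.
Proof. by have := mulq_conj (qconj x); rewrite qconjK qnorm2_conj. Qed.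

(** The Cayley-Hamilton identity, the source of the three-term recurrences
    below. *)
Lemma sqr_quat x : x ^+ 2 = (2 * qre x) *: x - (qnorm2 x)%:A.
Proof. by rewrite expr2; quat_ring. Qed.

Lemma exprSS_quat x n :
  x ^+ n.+2 = (2 * qre x) *: x ^+ n.+1 - qnorm2 x *: x ^+ n.
Proof.
rewrite -[n.+2]addn2 exprD sqr_quat mulrBr -!scalerAr mulr1.
by rewrite -exprSr.
Qed.

Lemma qdot_re a x : qdot a x = qre (x * qconj a).
Proof.
rewrite /qdot big_ord4 /= qmulE /qmul /qconj /qre !qE //= /qcoord.
by ring.
Qed.

(** The Cauchy-Riemann-Fueter operator maps the linear function q x r of x to
    (q + iqi + jqj + kqk) r. *)
Lemma sum_basis_conj x :
  x + qi R * x * qi R + qj R * x * qj R + qk R * x * qk R = - (2 *: qconj x).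
Proof.
have -> : qi R * x * qi R = Quat (- qcoord 0 x) (- qcoord 1 x) (qcoord 2 x) (qcoord 3 x).
  have -> : qi R * x = Quat (- qcoord 1 x) (qcoord 0 x) (- qcoord 3 x) (qcoord 2 x).
    by quat_ring.
  by quat_ring.
have -> : qj R * x * qj R = Quat (- qcoord 0 x) (qcoord 1 x) (- qcoord 2 x) (qcoord 3 x).
  have -> : qj R * x = Quat (- qcoord 2 x) (qcoord 3 x) (qcoord 0 x) (- qcoord 1 x).
    by quat_ring.
  by quat_ring.
have -> : qk R * x * qk R = Quat (- qcoord 0 x) (qcoord 1 x) (qcoord 2 x) (- qcoord 3 x).
  have -> : qk R * x = Quat (- qcoord 3 x) (- qcoord 2 x) (qcoord 1 x) (qcoord 0 x).
    by quat_ring.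
  by quat_ring.
by quat_ring.
Qed.

(** The common value of the spherical derivative of x^(n+1) and, up to the factor
    n + 1, of the zonal harmonic with pole 1. *)
Definition qcheb n x : R := peval (zpoly 1 n) x.

Lemma qcheb0 x : qcheb 0 x = 1. Proof. exact: peval1. Qed.

Lemma qre_dot1 x : qdot 1 x = qre x.
Proof. by rewrite qdot_re qconj1 mulr1. Qed.

Lemma qcheb1 x : qcheb 1 x = 2 * qre x.
Proof. by rewrite /qcheb zpoly1 pevalZ peval_linpoly qre_dot1. Qed.

Lemma qchebSS n x :
  qcheb n.+2 x = 2 * qre x * qcheb n.+1 x - qnorm2 x * qcheb n x.
Proof.
rewrite /qcheb zpolySS /peval mevalB -!/(peval _ _).
by rewrite pevalZ !pevalM peval_linpoly peval_normpoly qre_dot1 mulrA.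
Qed.

(** Right multiplication by the conjugate of a is a rotation that sends the pole a
    to 1, and both a . x and |x|^2 are read off the rotated point. *)
Lemma peval_zpoly_mul_conj a n x : qnorm2 a = 1 ->
  peval (zpoly a n) x = qcheb n (x * qconj a).
Proof.
move=> a1; elim/nat_ind2: n => [||n IHn IHn1].
- by rewrite qcheb0 zpoly0 peval1.
- by rewrite qcheb1 zpoly1 pevalZ peval_linpoly qdot_re.
- rewrite qchebSS -IHn -IHn1 zpolySS /peval mevalB -!/(peval _ _).
  rewrite pevalZ !pevalM peval_linpoly peval_normpoly qdot_re mulrA.
  by rewrite qnorm2M qnorm2_conj a1 mulr1.
Qed.

Lemma qcheb_conj n x : qcheb n (qconj x) = qcheb n x.
Proof.
elim/nat_ind2: n => [||n IHn IHn1]; first by rewrite !qcheb0.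
  by rewrite !qcheb1 qre_conj.
by rewrite !qchebSS IHn IHn1 qre_conj qnorm2_conj.
Qed.

Lemma qchebZ n c x : qcheb n (c *: x) = c ^+ n * qcheb n x.
Proof. exact: peval_homogZ (dhomog_zpoly 1 n). Qed.

(** The sum satisfies the recurrence of qcheb: peel off a factor x on the left, and
    note that the sums left over are real by induction, hence central. *)
Lemma sum_conj_powers n x :
  \sum_(0 <= k < n.+1) x ^+ (n - k) * qconj x ^+ k = (qcheb n x)%:A.
Proof.
have recl k : \sum_(0 <= j < k.+2) x ^+ (k.+1 - j) * qconj x ^+ j =
  x * (\sum_(0 <= j < k.+1) x ^+ (k - j) * qconj x ^+ j) + qconj x ^+ k.+1.
  rewrite big_nat_recr //= subnn mul1r big_distrr /=; congr (_ + _).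
  by apply: eq_big_nat => j /andP[_ jk]; rewrite mulrA -exprS subSn.
elim/nat_ind2: n => [||n IHn IHn1].
- by rewrite big_nat1 mulr1 qcheb0 scale1r.
- rewrite big_nat_recr // big_nat1 /= mulr1 mul1r.
  by rewrite qcheb1 -addq_conj.
have e : qconj x ^+ n.+2 = ((qcheb n.+1 x)%:A - x * (qcheb n x)%:A) * qconj x.
  by rewrite -IHn1 recl IHn addrAC subrr add0r -exprSr.
rewrite recl IHn1 e qchebSS !mulr_algr mulrBl mulr_algl -scalerAl mulq_conj.
rewrite addrA -scalerDr addq_conj scalerA scalerBl.
by rewrite !scalerA mulrC; congr (_ - _ *: _); exact: mulrC.
Qed.

Lemma subX_conj n x : x ^+ n.+1 - qconj x ^+ n.+1 = (2 * qcheb n x) *: qim x.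
Proof.
elim/nat_ind2: n => [||n IHn IHn1].
- by rewrite !expr1 subq_conj qcheb0 mulr1.
- rewrite !sqr_quat qre_conj qnorm2_conj opprB addrA addrNK -scalerBr.
  by rewrite subq_conj scalerA qcheb1 mulrC.
rewrite !(exprSS_quat _ n.+1) qre_conj qnorm2_conj opprD opprK addrACA -scalerBr IHn1.
rewrite [X in _ + X]addrC -scalerBr -opprB IHn scalerN !scalerA -scalerBl qchebSS.
by congr (_ *: _); ring.
Qed.

Lemma exprS_qcheb n x :
  x ^+ n.+1 = (qcheb n.+1 x)%:A - qconj x * (qcheb n x)%:A.
Proof.
rewrite mulr_algr; elim/nat_ind2: n => [||n IHn IHn1].
- by rewrite expr1 qcheb0 qcheb1 scale1r -addq_conj addrK.
- rewrite sqr_quat qchebSS qcheb1 qcheb0 mulr1 scalerBl.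
  rewrite -(scalerA (2 * qre x)) -addq_conj scalerDr.
  by rewrite addrAC addrK.
rewrite exprSS_quat IHn IHn1 (qchebSS n.+1) [X in _ = _ - X *: _]qchebSS.
rewrite !scalerBl !scalerBr !scalerA.
by rewrite !opprB addrACA [RHS]addrACA; congr (_ + _); exact: addrC.
Qed.

End QuaternionAlgebra.

(** * Spherical derivatives *)

Section SphericalDerivative.
Variable R : realType.
Implicit Types (x y z a v : quat R) (c : R) (f g : quat R -> quat R).

Let qE := (@qcoordD R, @qcoordN R, @qcoordZ R, @qcoord0 R, @qcoordE R).

Lemma continuous_scalar (h : quat R -> R) x : {for x, continuous h} ->
  {for x, continuous (fun y => (h y)%:A : quat R)}.
Proof. by move=> ch; exact: (@continuousZr_tmp _ _ _ _ (1 : quat R) x ch). Qed.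

(** A real point is a limit of non-real ones, say along the direction i. *)
Lemma nonreal_proper x : ProperFilter (within [set y | qim y != 0] (nbhs x)).
Proof.
apply: Build_ProperFilter_ex => A; rewrite /within /= => nA.
have [x0|] := eqVneq (qim x) 0; last first.
  by move=> x0; exists x; exact: (nbhs_singleton nA).
have cx : (x + t *: qi R) @[t --> (0 : R)^'] --> x.
  rewrite -[X in _ --> X]addr0 -(scale0r (qi R)).
  apply: cvgD; first exact: cvg_cst.
  by apply: cvgZr_tmp; apply: cvg_within_filter; exact: cvg_id.
have /filter_ex[t [t0 At]] : \forall t \near (0 : R)^',
    t != 0 /\ (qim (x + t *: qi R) != 0 -> A (x + t *: qi R)).
  near=> t; split; first by near: t; exact: nbhs_dnbhs_neq.
  by near: t; exact: (cx _ nA).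
exists (x + t *: qi R); apply: At.
apply/eqP => /(congr1 (qcoord 1)) /eqP.
have := congr1 (qcoord 1) x0.
rewrite /qim /qi !qE //= => ->.
by rewrite add0r mulr1 (negbTE t0).
Unshelve. all: by end_near. Qed.

(** A continuous extension of the difference quotient is the spherical derivative,
    at real points too. *)
Lemma sph_deriv_near f g x : {for x, continuous g} ->
  (\forall y \near x, qim y != 0 -> sph_quot f y = g y) -> sph_deriv f x = g x.
Proof.
move=> cg fg; rewrite /sph_deriv; case: ifP => [x0|_].
  exact: (nbhs_singleton fg).
have := nonreal_proper x => PF.
apply: cvg_lim; first exact: norm_hausdorff.
apply: (@cvg_trans _ (g y @[y --> within [set y | qim y != 0] (nbhs x)])).
  apply: near_eq_cvg; rewrite /within /=.
  by apply: filterS fg => y fgy y0; rewrite fgy.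
apply: cvg_within_filter; exact: cg.
Qed.

End SphericalDerivative.

(** * Spherical derivatives of powers *)

Section Powers.
Variable R : realType.
Implicit Types (x y z a v : quat R) (c : R) (f g : quat R -> quat R).

Lemma continuous_qcheb n : continuous (qcheb n : quat R -> R).
Proof. exact: continuous_peval. Qed.

Lemma continuous_qnorm2 : continuous (@qnorm2 R : quat R -> R).
Proof.
have -> : @qnorm2 R = peval (normpoly R) by apply/funext => x; rewrite peval_normpoly.
exact: continuous_peval.
Qed.

Lemma sph_quotX n x : qim x != 0 ->
  sph_quot (fun y => y ^+ n.+1) x = (qcheb n x)%:A.
Proof.
move=> x0; rewrite /sph_quot subX_conj -scalerAr mulVr ?scalerA //.
by rewrite mulrA mulVf ?mul1r // pnatr_eq0.
Qed.

Lemma sph_derivX n x : sph_deriv (fun y => y ^+ n.+1) x = (qcheb n x)%:A.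
Proof.
apply: (sph_deriv_near (g := fun y => (qcheb n y)%:A)).
  exact/continuous_scalar/continuous_qcheb.
by near=> y => y0; exact: sph_quotX.
Unshelve. all: by end_near. Qed.

Lemma exprVn_quat n x : x != 0 -> x ^- n = (qnorm2 x ^- n) *: qconj x ^+ n.
Proof.
move=> x0; rewrite -exprVn.
have -> : x^-1 = (qnorm2 x)^-1 *: qconj x by [].
by rewrite exprZn exprVn.
Qed.

Lemma sph_quotXN n x : x != 0 -> qim x != 0 ->
  sph_quot (fun y => y ^- n.+1) x = - (qcheb n x / qnorm2 x ^+ n.+1)%:A.
Proof.
move=> x0 ix0; have cx0 : qconj x != 0 by rewrite -qnorm2_eq0 qnorm2_conj qnorm2_eq0.
rewrite /sph_quot !exprVn_quat // qnorm2_conj qconjK -scalerBr -opprB subX_conj.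
rewrite -scalerAr mulrN -scalerAr mulVr // scalerN scalerN !scalerA; congr (- (_ *: _)).
by field; rewrite expf_neq0 ?qnorm2_eq0.
Qed.

Lemma sph_derivXN n x : x != 0 ->
  sph_deriv (fun y => y ^- n.+1) x = - (qcheb n x / qnorm2 x ^+ n.+1)%:A.
Proof.
move=> x0; apply: (sph_deriv_near (g := fun y => - (qcheb n y / qnorm2 y ^+ n.+1)%:A)).
  apply: continuousN; apply: continuous_scalar.
  apply: continuousM; first exact: continuous_qcheb.
  apply: (@continuousV _ _ (fun y => qnorm2 y ^+ n.+1)).
    by rewrite expf_neq0 // qnorm2_eq0.
  apply: (@continuous_comp _ _ _ (@qnorm2 R) (fun t => t ^+ n.+1)).
    exact: continuous_qnorm2.
  exact: exprn_continuous.
have := near_neq (@norm_hausdorff _ _) x0; apply: filterS => y y0; exact: sph_quotXN.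
Qed.

Lemma kelvin_sph_derivX n x : x != 0 ->
  kelvin (sph_deriv (fun y => y ^+ n.+1)) x = (qcheb n x / qnorm2 x ^+ n.+1)%:A.
Proof.
move=> x0; rewrite /kelvin sph_derivX qchebZ scalerA qabs2; congr (_ *: _).
by rewrite mulrA -exprS exprVn mulrC.
Qed.

(** For the parameter 1 the recurrence of the Gegenbauer polynomials is that of the
    Chebyshev polynomials of the second kind. *)
Lemma qcheb_gegenbauer n x : unit_sphere x -> qcheb n x = (gegenbauer 1 n).[qre x].
Proof.
move=> /unit_sphereE x1; elim/nat_ind2: n => [||n IHn IHn1].
- by rewrite qcheb0 hornerC.
- by rewrite qcheb1 /= mulr1 hornerZ hornerX.
rewrite qchebSS x1 mul1r IHn IHn1.
have -> : gegenbauer 1 n.+2 = (n.+2%:R)^-1 *: ((2 * (n.+1%:R + 1)) *: ('X * gegenbauer 1 n.+1)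
                        - (n%:R + 2 * 1) *: gegenbauer 1 n) :> {poly R} by [].
rewrite !(hornerE, hornerZ) /=.
by field; rewrite -(natrD _ 2 n) pnatr_eq0.
Qed.

End Powers.

(** * The Cauchy-Riemann-Fueter operator and negative powers *)

Section Differentiation.
Variable R : realType.
Implicit Types (x y z a v : quat R) (c : R) (f g : quat R -> quat R).

Let qE := (@qcoordD R, @qcoordN R, @qcoordZ R, @qcoord0 R, @qcoordE R).

Lemma is_derive_quatP f x v (l : quat R) :
  (forall n, (n < 4)%N -> is_derive x v (fun y => qcoord n (f y)) (qcoord n l)) <->
  is_derive x v f l.
Proof.
split=> [df|[df dl] n n4].
  have d : derivable (f : quat R -> 'rV[R]_4) x v.
    apply/derivable_mxP => i j; rewrite ord1.
    by have [] := df j (ltn_ord j); rewrite /qcoord inord_val.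
  apply: DeriveDef => //; apply: quatP => n n4; have [_ <-] := df n n4.
  by rewrite (derive_mx d) /qcoord mxE.
have d := (derivable_mxP (f : quat R -> 'rV[R]_4) x v).1 df ord0 (inord n).
by apply: DeriveDef => //; rewrite -dl (derive_mx df) /qcoord mxE.
Qed.

(** The product is bilinear in the coordinates, so the Leibniz rule holds, with the
    order of the factors kept. *)
Lemma is_derive_qmul f g x v (df dg : quat R) :
  is_derive x v f df -> is_derive x v g dg ->
  is_derive x v (fun y => f y * g y) (df * g x + f x * dg).
Proof.
move=> /is_derive_quatP hf /is_derive_quatP hg; apply/is_derive_quatP.
have M i j : (i < 4)%N -> (j < 4)%N -> is_derive x v
    (fun y => qcoord i (f y) * qcoord j (g y))
    (qcoord i df * qcoord j (g x) + qcoord i (f x) * qcoord j dg).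
  move=> i4 j4; apply: (is_derive_eq (is_deriveM (hf i i4) (hg j j4))).
  by rewrite /GRing.scale /= addrC mulrC.
have B (p q : quat R -> R) (dp dq : R) : is_derive x v p dp -> is_derive x v q dq ->
    is_derive x v (fun y => p y - q y) (dp - dq) by exact: is_deriveB.
have D (p q : quat R -> R) (dp dq : R) : is_derive x v p dp -> is_derive x v q dq ->
    is_derive x v (fun y => p y + q y) (dp + dq) by exact: is_deriveD.
move=> [|[|[|[|//]]]] _; rewrite qcoordD !qmulE !qE //=.
- have -> : (fun y => qcoord 0 (f y * g y)) = (fun y =>
    qcoord 0 (f y) * qcoord 0 (g y) - qcoord 1 (f y) * qcoord 1 (g y)
    - qcoord 2 (f y) * qcoord 2 (g y) - qcoord 3 (f y) * qcoord 3 (g y)).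
    by apply/funext => y; rewrite qmulE qcoordE.
  apply: (is_derive_eq (B _ _ _ _ (B _ _ _ _ (B _ _ _ _
    (M 0 0 _ _) (M 1 1 _ _)) (M 2 2 _ _)) (M 3 3 _ _))) => //; ring.
- have -> : (fun y => qcoord 1 (f y * g y)) = (fun y =>
    qcoord 0 (f y) * qcoord 1 (g y) + qcoord 1 (f y) * qcoord 0 (g y)
    + qcoord 2 (f y) * qcoord 3 (g y) - qcoord 3 (f y) * qcoord 2 (g y)).
    by apply/funext => y; rewrite qmulE qcoordE.
  apply: (is_derive_eq (B _ _ _ _ (D _ _ _ _ (D _ _ _ _
    (M 0 1 _ _) (M 1 0 _ _)) (M 2 3 _ _)) (M 3 2 _ _))) => //; ring.
- have -> : (fun y => qcoord 2 (f y * g y)) = (fun y =>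
    qcoord 0 (f y) * qcoord 2 (g y) - qcoord 1 (f y) * qcoord 3 (g y)
    + qcoord 2 (f y) * qcoord 0 (g y) + qcoord 3 (f y) * qcoord 1 (g y)).
    by apply/funext => y; rewrite qmulE qcoordE.
  apply: (is_derive_eq (D _ _ _ _ (D _ _ _ _ (B _ _ _ _
    (M 0 2 _ _) (M 1 3 _ _)) (M 2 0 _ _)) (M 3 1 _ _))) => //; ring.
- have -> : (fun y => qcoord 3 (f y * g y)) = (fun y =>
    qcoord 0 (f y) * qcoord 3 (g y) + qcoord 1 (f y) * qcoord 2 (g y)
    - qcoord 2 (f y) * qcoord 1 (g y) + qcoord 3 (f y) * qcoord 0 (g y)).
    by apply/funext => y; rewrite qmulE qcoordE.
  apply: (is_derive_eq (D _ _ _ _ (B _ _ _ _ (D _ _ _ _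
    (M 0 3 _ _) (M 1 2 _ _)) (M 2 1 _ _)) (M 3 0 _ _))) => //; ring.
Qed.

Lemma is_derive_exprn n x v :
  is_derive x v (fun y => y ^+ n) (\sum_(k < n) x ^+ (n - k.+1) * v * x ^+ k).
Proof.
elim: n => [|n IHn].
  by rewrite big_ord0; exact: is_derive_cst.
have -> : (fun y : quat R => y ^+ n.+1) = (fun y => y * y ^+ n).
  by apply/funext => y; rewrite exprS.
apply: (is_derive_eq (is_derive_qmul (is_derive_id x v) IHn)).
rewrite big_ord_recr /= subnn mul1r addrC; congr (_ + _).
rewrite big_distrr /=; apply: eq_bigr => k _.
by rewrite !mulrA -exprS subSS -subSn.
Qed.

(** Summing x^(n-k) e x^k over the basis replaces x^(n-k) by -2 times its conjugate;
    the sum over k is then a sum of products of powers of x and its conjugate. *)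
Lemma dCRF_exprn n x :
  dCRF (fun y => y ^+ n.+1) x = - (2 *: (qcheb n x)%:A).
Proof.
rewrite /dCRF.
have D v : 'D_v (fun y : quat R => y ^+ n.+1) x
    = \sum_(k < n.+1) x ^+ (n - k) * v * x ^+ k.
  by have [_ ->] := is_derive_exprn n.+1 x v; under eq_bigr do rewrite subSS.
rewrite !D !big_distrr -!big_split /= -[X in _ *: X%:A]qcheb_conj -sum_conj_powers.
rewrite big_mkord qconjK scaler_sumr -sumrN; apply: eq_bigr => k _.
by rewrite mulr1 !mulrA -!mulrDl sum_basis_conj qconjX mulNr -scalerAl.
Qed.

Implicit Types (P : mpoly 4 R).

Local Notation "''X_' i" := (mpolyX R (mnm1 i)) (at level 8, i at level 2, format "''X_' i").

(** Functions P / |x|^(2k) away from the origin, a class closed under partial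
    derivatives. *)
Definition rat_on f P k := forall x, x != 0 -> f x = (peval P x / qnorm2 x ^+ k)%:A.

(** The numerator of the i-th partial derivative of P / |x|^(2k), over the
    denominator |x|^(2k+2). *)
Definition rat_mderiv k i P : mpoly 4 R :=
  normpoly R * mderiv i P - (2 * k%:R) *: ('X_i * P).

Lemma is_derive_qnorm2 x i :
  is_derive x (qbase R i) (@qnorm2 R : quat R -> R) (2 * x ord0 i).
Proof.
have -> : @qnorm2 R = peval (normpoly R) by apply/funext => y; rewrite peval_normpoly.
have -> : 2 * x ord0 i = peval (mderiv i (normpoly R)) x.
  by rewrite mderiv_normpoly pevalZ /peval mevalXU.
exact: peval_is_derive.
Qed.

Lemma rat_is_derive P k x i : x != 0 ->
  is_derive x (qbase R i) (fun y => peval P y / qnorm2 y ^+ k)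
    (peval (rat_mderiv k i P) x / qnorm2 x ^+ k.+1).
Proof.
move=> x0; have n0 : qnorm2 x != 0 by rewrite qnorm2_eq0.
have dN : is_derive x (qbase R i) (fun y => qnorm2 y ^+ k)
    (k%:R * qnorm2 x ^+ k.-1 * (2 * x ord0 i)).
  have -> : (fun y : quat R => qnorm2 y ^+ k) = @qnorm2 R ^+ k.
    by apply/funext => y; rewrite exprfctE.
  exact: is_deriveX (is_derive_qnorm2 x i).
have dV : is_derive x (qbase R i) (fun y => (qnorm2 y ^+ k)^-1)
    (- (qnorm2 x ^+ k) ^- 2 * (k%:R * qnorm2 x ^+ k.-1 * (2 * x ord0 i))).
  case: dN => d1 d2; have nk : qnorm2 x ^+ k != 0 by rewrite expf_neq0.
  apply: DeriveDef; first exact: derivableV.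
  by rewrite deriveV // d2.
apply: (is_derive_eq (is_deriveM (peval_is_derive P i x) dV)).
rewrite /GRing.scale /= /rat_mderiv /peval mevalB mevalZ !mevalM mevalXU.
rewrite -!/(peval _ _) peval_normpoly.
case: k {dN dV} => [|k] /=; first by rewrite !expr0 expr1; field.
by rewrite !exprS; field; rewrite n0 expf_neq0.
Qed.

Lemma is_derive_scalar (h : quat R -> R) x v (dh : R) :
  is_derive x v h dh -> is_derive x v (fun y => (h y)%:A : quat R) dh%:A.
Proof.
move=> hd; apply/is_derive_quatP => n n4; rewrite qcoordZ.
have -> : (fun y => qcoord n ((h y)%:A : quat R)) = h * cst (qcoord n (1 : quat R)).
  by apply/funext => y; rewrite qcoordZ.
apply: (is_derive_eq (is_deriveM hd (is_derive_cst _ _ _))).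
by rewrite scaler0 add0r mulrC.
Qed.

Lemma rat_on_near f P k x : rat_on f P k -> x != 0 ->
  \forall y \near x, (peval P y / qnorm2 y ^+ k)%:A = f y.
Proof.
move=> fP x0; have := near_neq (@norm_hausdorff _ _) x0.
by apply: filterS => y /fP.
Qed.

Lemma rat_on_derive f P k x i : rat_on f P k -> x != 0 ->
  is_derive x (qbase R i) f (peval (rat_mderiv k i P) x / qnorm2 x ^+ k.+1)%:A.
Proof.
move=> fP x0; apply: near_eq_is_derive (rat_on_near fP x0) _.
exact/is_derive_scalar/rat_is_derive.
Qed.

Lemma rat_onD f P k i : rat_on f P k ->
  rat_on ('D_(qbase R i) f) (rat_mderiv k i P) k.+1.
Proof. by move=> fP x x0; have [_ ->] := rat_on_derive i fP x0. Qed.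

Lemma rat_on_continuous f P k x : rat_on f P k -> x != 0 -> {for x, continuous f}.
Proof.
move=> fP x0.
have c : {for x, continuous (fun y => (peval P y / qnorm2 y ^+ k)%:A : quat R)}.
  apply: continuous_scalar; apply: continuousM; first exact: continuous_peval.
  apply: (@continuousV _ _ (fun y => qnorm2 y ^+ k)).
    by rewrite expf_neq0 // qnorm2_eq0.
  apply: (@continuous_comp _ _ _ (@qnorm2 R) (fun t => t ^+ k)).
    exact: continuous_qnorm2.
  exact: exprn_continuous.
rewrite /continuous_at /prop_for (fP _ x0).
exact: cvg_trans (near_eq_cvg (rat_on_near fP x0)) c.
Qed.

(** The Kelvin transform preserves harmonicity: P / |x|^(2n+2) is the transform of P.
    After two derivatives the terms in d_i P add up to Euler's identity, and they
    cancel the derivatives of the denominator exactly for the degree n. *)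
Lemma rat_on_harmonic f P n : rat_on f P n.+1 -> homog_harmonic n P ->
  harmonic_on [set x : quat R | x != 0] f.
Proof.
move=> fP /homog_harmonicP[hP lP]; split.
- by rewrite openE => x /= /(near_neq (@norm_hausdorff _ _)).
- move=> x /= x0; split=> [|m]; first exact: rat_on_continuous fP x0.
  split; first by have [] := rat_on_derive m fP x0.
    exact: rat_on_continuous (rat_onD m fP) x0.
  move=> i; split; first by have [] := rat_on_derive i (rat_onD m fP) x0.
  exact: rat_on_continuous (rat_onD i (rat_onD m fP)) x0.
move=> x /= x0; rewrite /laplacian.
under eq_bigr => i _ do rewrite (rat_onD i (rat_onD i fP) x0).
rewrite -scaler_suml -big_distrl /=.
suff -> : \sum_(i < 4) peval (rat_mderiv n.+2 i (rat_mderiv n.+1 i P)) x = 0.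
  by rewrite mul0r scale0r.
have euler : \sum_(i < 4) x ord0 i * peval (mderiv i P) x = n%:R * peval P x.
  rewrite -pevalZ -(euler_homog hP) /peval raddf_sum; apply: eq_bigr => i _ /=.
  by rewrite mevalM mevalXU.
pose N := qnorm2 x.
(* The numerator of the second derivative, sorted by the order of the derivative
   of P. *)
transitivity (\sum_(i < 4) (N ^+ 2 * peval (mderiv i (mderiv i P)) x
   - 4%:R * n.+1%:R * N * (x ord0 i * peval (mderiv i P) x)
   - 2 * n.+1%:R * N * peval P x
   + 4%:R * n.+1%:R * n.+2%:R * peval P x * x ord0 i ^+ 2)).
  apply: eq_bigr => i _; rewrite /rat_mderiv !mderivB !mderivZ !mderivM mderiv_normpoly.
  rewrite mderivXU eqxx mul1r.
  rewrite /peval !(mevalB, mevalZ, mevalM, mevalD, mevalXU) -!/(peval _ _).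
  rewrite peval_normpoly -/N -[n.+2]addn1 natrD; ring.
rewrite !big_split /= !sumrN -!big_distrr /= euler -qnorm2E -/N sumr_const card_ord.
have -> : \sum_(i < 4) peval (mderiv i (mderiv i P)) x = 0.
  by rewrite -[RHS](lP x) /peval raddf_sum.
rewrite -[n.+2]addn2 -addn1 !natrD; ring.
Qed.

Lemma harmonic_sph_derivXN n :
  harmonic_on [set x : quat R | x != 0] (sph_deriv (fun y => y ^- n.+1)).
Proof.
have hn : homog_harmonic n (-1 *: zpoly 1 n : mpoly 4 R).
  exact/homog_harmonicZ/homog_harmonic_zpoly/unit_sphereE/unit_sphere1.
apply: (rat_on_harmonic _ hn) => x x0.
by rewrite sph_derivXN // /peval mevalZ mulN1r mulNr scaleNr.
Qed.

End Differentiation.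

(** * The Koebe function *)

Lemma derivable_koebe_fraction (K : numFieldType) (z : K) : z != 1 ->
  derivable (fun y : K^o => y / (1 - y) ^+ 2 : K^o) z 1.
Proof.
move=> z1.
have d1 : derivable (cst 1 - id : K -> K) z 1.
  by apply: derivableB; [exact: derivable_cst|exact: derivable_id].
have d2 : derivable (fun y : K => (1 - y) ^+ 2) z 1.
  have -> : (fun y : K => (1 - y) ^+ 2) = (cst 1 - id) ^+ 2.
    by apply/funext => y; rewrite exprfctE.
  exact: derivableX.
have d3 : derivable (fun y : K => ((1 - y) ^+ 2)^-1) z 1.
  by apply: derivableV => //; rewrite expf_neq0 // subr_eq0 eq_sym.
have d4 := derivableM (@derivable_id _ _ z 1) d3.
exact: d4.
Qed.

Section Koebe.
Variable R : realType.
Implicit Types (x y a : quat R) (z w : R[i]) (J : quat R).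

Let qE := (@qcoordD R, @qcoordN R, @qcoordZ R, @qcoord0 R, @qcoordE R).

Lemma poissonE x a : poisson x a = (1 - qnorm2 x) / qnorm2 (x - a) ^+ 2.
Proof. by rewrite /poisson -[4%N]/(2 * 2)%N exprM !qabs2. Qed.

(** With M = |x - 1|^2, (1 - x)^-2 is M^-2 times the square of the conjugate of
    1 - x, and the difference of the numerators at x and its conjugate is
    (1 - |x|^2) times the difference of the points. *)
Lemma sph_quot_koebe x : x != 1 -> qim x != 0 ->
  sph_quot (@koebe R) x = (poisson x 1)%:A.
Proof.
move=> x1 ix0.
have qN y : qnorm2 (- y) = qnorm2 y by rewrite /qnorm2 !qE !sqrrN.
have k y : y != 1 -> koebe y
    = (qnorm2 (y - 1) ^+ 2)^-1 *: (y - (2 * qnorm2 y)%:A + qnorm2 y *: qconj y).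
  move=> y1; rewrite /koebe exprVn_quat; last by rewrite subr_eq0 eq_sym.
  rewrite -(opprB y) qN opprB -scalerAl; congr (_ *: _).
  rewrite qconjB qconj1 expr2 -mulrA [(1 - _) * y]mulrBl mul1r mulconj_q.
  rewrite mulrBl mul1r mulrBr mulconj_q mulr_algr.
  move: (qnorm2 y) => N.
  by rewrite mulr_natl mulr2n scalerDl opprB [_ *: _ - _]addrC opprD !addrA.
have x1' : qconj x != 1.
  by apply: contra x1 => /eqP /(congr1 (@qconj R)); rewrite qconjK qconj1 => ->.
have Nc : qnorm2 (qconj x - 1) = qnorm2 (x - 1) by rewrite -[RHS]qnorm2_conj qconjB qconj1.
rewrite /sph_quot !k // Nc qnorm2_conj qconjK -scalerBr.
have -> : x - (2 * qnorm2 x)%:A + qnorm2 x *: qconj x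
    - (qconj x - (2 * qnorm2 x)%:A + qnorm2 x *: x) = (1 - qnorm2 x) *: (x - qconj x).
  rewrite scalerBl scale1r scalerBr [- (_ - _ + _)]opprD !opprB addrACA.
  by rewrite [_ - _ + (_ - _)]addrA subrK.
rewrite subq_conj -!scalerAr mulVr // !scalerA poissonE; congr (_ *: _).
by field; rewrite qnorm2_eq0 subr_eq0.
Qed.

Lemma unit_ball_neq1 x : unit_ball x -> x != 1.
Proof.
by rewrite /unit_ball /= => x1; apply: contraTneq x1 => ->; rewrite -leNgt (unit_sphere1 R).
Qed.

Lemma sph_deriv_koebe x : unit_ball x -> sph_deriv (@koebe R) x = (poisson x 1)%:A.
Proof.
move=> /unit_ball_neq1 x1; apply: (sph_deriv_near (g := fun y => (poisson y 1)%:A)).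
  apply: continuous_scalar.
  have -> : (fun y => poisson y 1) = (fun y => (1 - qnorm2 y) * (qnorm2 (y - 1) ^+ 2)^-1).
    by apply/funext => y; exact: poissonE.
  apply: continuousM.
    by apply: continuousB; [exact: cst_continuous|exact: continuous_qnorm2].
  apply: (@continuousV _ _ (fun y => qnorm2 (y - 1) ^+ 2)).
    by rewrite expf_neq0 // qnorm2_eq0 subr_eq0.
  apply: (@continuous_comp _ _ _ (fun y : quat R => qnorm2 (y - 1)) (fun t => t ^+ 2)).
    apply: (@continuous_comp _ _ _ (fun y : quat R => y - 1) (@qnorm2 R)).
      by apply: continuousB; [exact: cvg_id|exact: cst_continuous].
    exact: continuous_qnorm2.
  exact: exprn_continuous.
have := near_neq (@norm_hausdorff _ _) x1; apply: filterS => y y1; exact: sph_quot_koebe.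
Qed.

Lemma qabs_mul_conj x a : unit_sphere a -> qabs (x * qconj a) = qabs x.
Proof. by move=> /unit_sphereE a1; rewrite /qabs qnorm2M qnorm2_conj a1 mulr1. Qed.

(** Right multiplication by the conjugate of a preserves distances and sends a to 1. *)
Lemma poisson_mul_conj x a : unit_sphere a -> poisson (x * qconj a) 1 = poisson x a.
Proof.
move=> a1; rewrite /poisson qabs_mul_conj //; congr (_ / _ ^+ 4).
rewrite -[RHS](qabs_mul_conj _ a1) mulrBl mulq_conj.
by move/unit_sphereE: a1 => ->; rewrite scale1r.
Qed.

(* For an imaginary unit J, slice_pt embeds the complex field in the quaternions. *)
Section Slice.
Variable J : quat R.
Hypothesis J1 : J ^+ 2 = -1.

Lemma slice_ptB z w : slice_pt (z - w) J = slice_pt z J - slice_pt w J.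
Proof.
case: z w => [a b] [c d]; rewrite /slice_pt /= !scalerBl mulrBr opprD addrACA.
by [].
Qed.

Lemma slice_pt1 : slice_pt 1 J = 1.
Proof. by rewrite /slice_pt /= scale1r scale0r mulr0 addr0. Qed.

Lemma slice_ptM z w : slice_pt (z * w) J = slice_pt z J * slice_pt w J.
Proof.
case: z w => [a b] [c d]; rewrite /slice_pt /= !mulr_algr.
rewrite mulrDl !mulrDr -!scalerAl -!scalerAr !mulr1 !mul1r -expr2 J1.
rewrite !scalerA !scalerBl !scalerDl scalerN.
by rewrite addrACA [- _ + _]addrC.
Qed.

Lemma slice_ptV z : z != 0 -> slice_pt z^-1 J = (slice_pt z J)^-1.
Proof.
move=> z0; have e : slice_pt z J * slice_pt z^-1 J = 1.
  by rewrite -slice_ptM divff // slice_pt1.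
have u : slice_pt z J \is a GRing.unit.
  by apply: (contra_eqN _ e) => /eqP ->; rewrite mul0r eq_sym oner_eq0.
by apply: (mulrI u); rewrite e divrr.
Qed.

Lemma slice_pt_eq0 z : (slice_pt z J == 0) = (z == 0).
Proof.
apply/eqP/eqP => [e|->]; last by rewrite /slice_pt /= !scale0r mulr0 addr0.
apply/eqP/negPn/negP => z0; have /eqP := slice_ptM z z^-1.
by rewrite divff // slice_pt1 e mul0r oner_eq0.
Qed.

Lemma koebe_slice_pt z : z != 1 -> koebe (slice_pt z J) = slice_pt (z / (1 - z) ^+ 2) J.
Proof.
move=> z1; have z1' : 1 - z != 0 by rewrite subr_eq0 eq_sym.
rewrite [z / _]mulrC slice_ptM slice_ptV ?expf_neq0 // expr2 slice_ptM slice_ptB slice_pt1.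
by rewrite -expr2.
Qed.

End Slice.

(** J is the direction of the imaginary part, or any imaginary unit at a real
    point. *)
Lemma slice_decomp x : exists z J, J ^+ 2 = -1 /\ x = slice_pt z J.
Proof.
have xE : x = (qre x)%:A + qim x.
  by apply: quatP => -[|[|[|[|//]]]] _; rewrite qoneE /qre /qim !qE //=; ring.
pose b := qabs (qim x).
have [b0|b0] := eqVneq b 0.
  exists (Complex (qre x) 0), (qi R); split.
    rewrite expr2 qmulE qoneE /qmul /qi.
    by apply: quatP => -[|[|[|[|//]]]] _; rewrite !qE //=; ring.
  have q0 : qim x = 0 by apply/eqP; rewrite -qnorm2_eq0 -qabs2 -/b b0 expr0n.
  by rewrite {1}xE q0 /slice_pt /= scale0r mulr0.
exists (Complex (qre x) b), (b^-1 *: qim x); split.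
  have -> : (b^-1 *: qim x) ^+ 2 = b^-1 ^+ 2 *: qim x ^+ 2 by rewrite exprZn.
  have re0 : qre (qim x) = 0 by rewrite /qre /qim !qE.
  rewrite sqr_quat re0 mulr0 scale0r sub0r scalerN scalerA -qabs2 -/b.
  by rewrite -exprMn mulVf // expr1n scale1r.
by rewrite {1}xE /slice_pt /= mulr_algr scalerA divff // scale1r.
Qed.

(** The Koebe function has real coefficients, so its stem function is the complex
    Koebe function z / (1 - z)^2, carried by the unit 1 of the quaternions. *)
Lemma koebe_slice_regular : slice_regular [set x : quat R | x != 1] (@koebe R).
Proof.
exists [set z | z != 1], (fun z => (z / (1 - z) ^+ 2) *: delta_mx ord0 ord0).
split; split.
- by rewrite openE => z /= /(near_neq (@norm_hausdorff _ R[i]^o)).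
- by move=> z /=; rewrite fmorph_eq1.
- apply/seteqP; split=> [x /= x1|x /= [z [J [z1 J1 ->]]]].
    have [z [J [J1 xE]]] := slice_decomp x; exists z, J; split=> //=.
    by apply: contra x1 => /eqP z1; rewrite xE z1 slice_pt1.
  by rewrite -subr_eq0 -(slice_pt1 J) -slice_ptB slice_pt_eq0 // subr_eq0.
- move=> z _; apply/rowP => j; rewrite !mxE.
  have -> w : conjc w = Num.conj w by [].
  by rewrite !rmorphM fmorphV !rmorphM !rmorphB rmorph1 rmorph_nat.
- move=> z /= z1; apply/diff_derivable/differentiableZl/derivable1_diffP.
  exact: derivable_koebe_fraction.
- move=> z J z1 J1; rewrite koebe_slice_pt // /slice_pt; move: (z / _) => w.
  by congr (_ + _ * _); apply: quatP => -[|[|[|[|//]]]] _;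
    rewrite /qcoord !mxE !inordK // -?val_eqE /= ?inordK //= ?mulr1 ?mulr0.
Qed.

End Koebe.

(** * Powers, zonal harmonics and the Poisson kernel *)

Theorem corollary6p7 (R : realType) :
  (forall (m : nat) (a : quat R), (1 <= m)%N -> unit_sphere a ->
    [/\ (* (a) *)
        (forall x : quat R,
          (zonal m.-1 x 1)%:A = m%:R *: sph_deriv (fun y => y ^+ m) x) /\
        (forall x : quat R,
          dCRF (fun y => y ^+ m) x = - (2 / m%:R * zonal m.-1 x 1)%:A),
        (* (b) *)
        (forall x : quat R,
          [/\ zonal m.-1 x a = zonal m.-1 (x * qconj a) 1,
              (zonal m.-1 (x * qconj a) 1)%:A
                = m%:R *: sph_deriv (fun y => y ^+ m) (x * qconj a) &
              m%:R *: sph_deriv (fun y => y ^+ m) (x * qconj a)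
                = m%:R *: \sum_(0 <= k < m)
                    (x * qconj a) ^+ (m - k - 1) * (a * qconj x) ^+ k]),
        (* (c) *)
        (forall x : quat R, x != 0 ->
          sph_deriv (fun y => y ^- m) x
            = - kelvin (sph_deriv (fun y => y ^+ m)) x) /\
        harmonic_on [set x : quat R | x != 0] (sph_deriv (fun y => y ^- m)),
        (* (d) *)
        (forall x : quat R,
          x ^+ m = ((m.+1%:R)^-1 * zonal m x 1)%:A
                   - qconj x * (m%:R^-1 * zonal m.-1 x 1)%:A) &
        (* (e) *)
        (forall x : quat R, unit_sphere x ->
          sph_deriv (fun y => y ^+ m) x = (gegenbauer 1 m.-1).[qre x]%:A)]) /\
  (* (f) *)
  slice_regular [set x : quat R | x != 1] (@koebe R) /\
  (forall x a : quat R, unit_ball x -> unit_sphere a ->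
    sph_deriv (@koebe R) x = (poisson x 1)%:A /\
    sph_deriv (@koebe R) (x * qconj a) = (poisson x a)%:A).
Proof.
split; last first.
  split; first exact: koebe_slice_regular.
  move=> x a x1 a1; split; first exact: sph_deriv_koebe.
  rewrite -poisson_mul_conj //; apply: sph_deriv_koebe.
  by rewrite /unit_ball /= qabs_mul_conj.
move=> [//|n] a _ a1; rewrite !succnK.
have n0 : n.+1%:R != 0 :> R by rewrite pnatr_eq0.
have zonal1 k (x : quat R) : zonal k x 1 = k.+1%:R * qcheb k x.
  by rewrite zonalE //; exact: unit_sphere1.
split.
- split=> x; first by rewrite zonal1 sph_derivX scalerA.
  by rewrite dCRF_exprn zonal1 mulrA divfK // scalerA.
- move=> x; rewrite zonal1 sph_derivX; split.
  + by rewrite zonalE // peval_zpoly_mul_conj //; exact/unit_sphereE.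
  + by rewrite scalerA.
  + rewrite -sum_conj_powers qconjM qconjK; congr (_ *: _).
    by apply: eq_bigr => k _; rewrite subnAC subn1.
- split=> [x x0|]; last exact: harmonic_sph_derivXN.
  by rewrite sph_derivXN // kelvin_sph_derivX.
- by move=> x; rewrite !zonal1 !mulKf ?pnatr_eq0 //; exact: exprS_qcheb.
- by move=> x x1; rewrite sph_derivX qcheb_gegenbauer.
Qed.
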